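(* Let $\delta\in(0,n]$, $p\in[1,\infty)$, $q\in(0,\infty)$ and $w\in\mathcal A_{p,\delta}$. Then there exists a positive constant $C$ such that, for any $f\in \mathrm{BMO}(\mathbb R^n,\mathcal H_\infty^\delta)$, $$\frac1C\|f\|_{\mathrm{BMO}(\mathbb R^n,\mathcal H_\infty^\delta)}\le\|f\|_{\mathrm{BMO}^q_w(\mathbb R^n,\mathcal H_\infty^\delta)}\le C\|f\|_{\mathrm{BMO}(\mathbb R^n,\mathcal H_\infty^\delta)}.$$
   Context: A cube $Q\subset\mathbb R^n$ is always left-open and right-closed with sides parallel to the coordinate axes; $l(Q)$ is its edge length. For $\delta\in(0,n]$ and $E\subset\mathbb R^n$ the Hausdorff content is $\mathcal H_\infty^\delta(E)=\inf\{\sum_i l(Q_i)^\delta: E\subset\bigcup_iQ_i\}$, the infimum over all finite or countable coverings by cubes. For any (not necessarily measurable) $f\ge0$, the Choquet integral is $\int_E f\,d\mathcal H_\infty^\delta=\int_0^\infty\mathcal H_\infty^\delta(\{x\in E:f(x)>t\})\,dt$. $L^1_{\rm loc}(\mathbb R^n,\mathcal H_\infty^\delta)$ is the set of functions with $\int_K|f|\,d\mathcal H_\infty^\delta<\infty$ for every compact $K$. A weight is a function $w\in L^1_{\rm loc}(\mathbb R^n,\mathcal H_\infty^\delta)$ with $w\in(0,\infty)$ $\mathcal H_\infty^\delta$-a.e. (i.e. outside a set of content zero). For $p\in(1,\infty)$, $\mathcal A_{p,\delta}$ is the set of weights with $[w]_{\mathcal A_{p,\delta}}=\sup_Q\{\frac1{\mathcal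 H_\infty^\delta(Q)}\int_Q w\,d\mathcal H_\infty^\delta\}\{\frac1{\mathcal H_\infty^\delta(Q)}\int_Q w^{-\frac1{p-1}}\,d\mathcal H_\infty^\delta\}^{p-1}<\infty$ (supremum over all cubes); $\mathcal A_{1,\delta}$ is the set of weights with $[w]_{\mathcal A_{1,\delta}}=\inf\{c\in(0,\infty):\mathcal M_{\mathcal H_\infty^\delta}w\le c\,w\ \ \mathcal H_\infty^\delta\text{-a.e.}\}<\infty$, where $\mathcal M_{\mathcal H_\infty^\delta}w(x)=\sup_{Q\ni x}\frac1{\mathcal H_\infty^\delta(Q)}\int_Q|w|\,d\mathcal H_\infty^\delta$. $w_{\mathcal H_\infty^\delta}(E)=\int_E w\,d\mathcal H_\infty^\delta$. $\mathrm{BMO}(\mathbb R^n,\mathcal H_\infty^\delta)$ is the set of real-valued $f\in L^1_{\rm loc}(\mathbb R^n,\mathcal H_\infty^\delta)$ with $$\|f\|_{\mathrm{BMO}(\mathbb R^n,\mathcal H_\infty^\delta)}=\sup_Q\inf_{c\in\mathbb R}\frac1{\mathcal H_\infty^\delta(Q)}\int_Q|f(x)-c|\,d\mathcal H_\infty^\delta<\infty,$$ and $$\|f\|_{\mathrm{BMO}^q_w(\mathbb R^n,\mathcal H_\infty^\delta)}=\sup_Q\inf_{c\in\mathbb R}\left[\frac1{w_{\mathcal H_\infty^\delta}(Q)}\int_Q|f(x)-c|^qw(x)\,d\mathcal H_\infty^\delta\right]^{1/q},$$ suprema over all cubes $Q$. *)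

(* Defs.v *)
From mathcomp Require Import all_boot all_order all_algebra.
From mathcomp Require Import all_classical all_reals all_analysis.

Set Implicit Arguments.
Unset Strict Implicit.
Unset Printing Implicit Defensive.

Import Order.TTheory GRing.Theory Num.Theory numFieldNormedType.Exports.

Local Open Scope classical_set_scope.
Local Open Scope ring_scope.

Record cube (R : realType) (n : nat) := Cube {
  corner : 'rV[R]_n;
  edge : {posnum R} }.

(* Left-open and right-closed in every coordinate. *)
Definition cube_set (R : realType) (n : nat) (Q : cube R n) : set 'rV[R]_n :=
  [set x | forall i, corner Q 0 i < x 0 i <= corner Q 0 i + (edge Q)%:num].

Coercion cube_set : cube >-> set.

Local Open Scope ereal_scope.

(* The index set D ranges over all subsets of nat, so the coverings are exactly
   the finite and the countable ones. *)
Definition hcontent (R : realType) (n : nat) (delta : R) (E : set 'rV[R]_n) :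
    \bar R :=
  ereal_inf [set s | exists (D : set nat) (Q : nat -> cube R n),
    E `<=` \bigcup_(i in D) cube_set (Q i) /\
    s = \esum_(i in D) ((edge (Q i))%:num `^ delta)%:E].

Definition content_ae (R : realType) (n : nat) (delta : R)
    (P : 'rV[R]_n -> Prop) : Prop :=
  hcontent delta [set x | ~ P x] = 0.

(* Meaningful for arbitrary, possibly nonmeasurable, f: only the nonincreasing
   distribution function is integrated. *)
Definition choquet (R : realType) (n : nat) (delta : R) (E : set 'rV[R]_n)
    (f : 'rV[R]_n -> \bar R) : \bar R :=
  \int[lebesgue_measure]_(t in `[0%R, +oo[)
    hcontent delta [set x | E x /\ t%:E < f x].

Definition choquet_avg (R : realType) (n : nat) (delta : R) (Q : cube R n)
    (f : 'rV[R]_n -> \bar R) : \bar R :=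
  (hcontent delta Q)^-1 * choquet delta Q f.

Definition L1loc (R : realType) (n : nat) (delta : R)
    (f : 'rV[R]_n -> \bar R) : Prop :=
  forall K : set 'rV[R]_n, compact K ->
    choquet delta K (fun x => `|f x|) < +oo.

Definition weight (R : realType) (n : nat) (delta : R)
    (w : 'rV[R]_n -> \bar R) : Prop :=
  L1loc delta w /\ content_ae delta (fun x => 0 < w x < +oo).

Definition maximal (R : realType) (n : nat) (delta : R)
    (w : 'rV[R]_n -> \bar R) (x : 'rV[R]_n) : \bar R :=
  ereal_sup [set choquet_avg delta Q (fun y => `|w y|) |
             Q in [set Q : cube R n | cube_set Q x]].

(* The power w^(-1/(p-1)) is written (w^-1)^(1/(p-1)): a negative exponent in
   poweR would send both 0 and +oo to themselves. *)
Definition Ap_const (R : realType) (n : nat) (delta p : R)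
    (w : 'rV[R]_n -> \bar R) : \bar R :=
  ereal_sup (range (fun Q : cube R n =>
    choquet_avg delta Q w *
    choquet_avg delta Q (fun x => (w x)^-1 `^ (p - 1)^-1) `^ (p - 1))).

Definition A1_const (R : realType) (n : nat) (delta : R)
    (w : 'rV[R]_n -> \bar R) : \bar R :=
  ereal_inf [set c%:E | c in [set c : R | (0 < c)%R /\
    content_ae delta (fun x => maximal delta w x <= c%:E * w x)]].

Definition A_const (R : realType) (n : nat) (delta p : R)
    (w : 'rV[R]_n -> \bar R) : \bar R :=
  if p == 1%R then A1_const delta w else Ap_const delta p w.

Definition A_class (R : realType) (n : nat) (delta p : R)
    (w : 'rV[R]_n -> \bar R) : Prop :=
  weight delta w /\ A_const delta p w < +oo.

Definition BMO_norm (R : realType) (n : nat) (delta : R)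
    (f : 'rV[R]_n -> R) : \bar R :=
  ereal_sup (range (fun Q : cube R n =>
    ereal_inf (range (fun c : R =>
      choquet_avg delta Q (fun x => `|f x - c|%:E))))).

Definition BMO (R : realType) (n : nat) (delta : R)
    (f : 'rV[R]_n -> R) : Prop :=
  L1loc delta (fun x => (f x)%:E) /\ BMO_norm delta f < +oo.

Definition wBMO_norm (R : realType) (n : nat) (delta q : R)
    (w : 'rV[R]_n -> \bar R) (f : 'rV[R]_n -> R) : \bar R :=
  ereal_sup (range (fun Q : cube R n =>
    ereal_inf (range (fun c : R =>
      ((choquet delta Q w)^-1 *
       choquet delta Q (fun x => (`|f x - c| `^ q)%:E * w x)) `^ q^-1)))).

(* Main.v *)
Require Import Defs.
From mathcomp Require Import all_boot all_order all_algebra.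
From mathcomp Require Import all_classical all_reals all_analysis.
From mathcomp Require Import measurable_realfun ring lra zify.

(* Write H for the content and w(E) for the Choquet integral of w over E.  H is
   not additive, but E |-> w(E) is countably subadditive, and the proof only
   uses subadditivity, Chebyshev and one covering principle (stopping_cover):
   a subset E of Q of small content is covered by subcubes P of Q whose costs
   add up to O(H(E)) and in each of which E fills at most half of P.
   - Applied to E = {|f - c_Q| > s}, it moves the constants c_P by at most 2 s
     and iterates to the exponential decay of John and Nirenberg; the
     hypothesis only bounds H(E), not an integral.
   - Applied to E = {w > s}, it gives w(E) = O(s H(E)), because A_p forces w to
     exceed a multiple of its average on most of each P.  Hence the tail
     T(s) of the layer-cake integral of w over Q satisfies T(s) <= theta T(s/2)
     and sets of exponentially small content have exponentially small weight.
   Combining both bounds the weighted norm by the BMO norm.  Conversely A_p and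
   Chebyshev turn a bound on the weighted norm into the hypothesis of the decay
   estimate, which is then used with the weight 1 and the exponent 1. *)

Set Implicit Arguments.
Unset Strict Implicit.
Unset Printing Implicit Defensive.

Import Order.TTheory GRing.Theory Num.Theory numFieldNormedType.Exports.

Local Open Scope classical_set_scope.
Local Open Scope ring_scope.
Local Open Scope ereal_scope.

(** * Hausdorff content: monotonicity and countable subadditivity *)

Section HausdorffContent.
Context {R : realType} {n : nat}.
Implicit Types (delta : R) (E : set 'rV[R]_n) (Q : cube R n).

Definition unit_cube : cube R n := Cube 0%R (PosNum ltr01).

Definition cost delta Q : R := (edge Q)%:num `^ delta.

Lemma cost_gt0 delta Q : (0 < cost delta Q)%R.
Proof. exact: powR_gt0. Qed.

Lemma cost_ge0 delta Q : 0 <= (cost delta Q)%:E.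
Proof. by rewrite lee_fin ltW// cost_gt0. Qed.

Lemma hcontent_ge0 delta E : 0 <= hcontent delta E.
Proof.
apply: le_ereal_inf_tmp => _ [D [Q [_ ->]]].
by apply: esum_ge0 => i _; exact: cost_ge0.
Qed.

Lemma le_hcontent delta E E' : E `<=` E' -> hcontent delta E <= hcontent delta E'.
Proof.
move=> EE'; apply: le_ereal_inf => s [D [Q [E'Q ->]]].
by exists D, Q; split => //; exact: subset_trans E'Q.
Qed.

Lemma hcontent0 delta : hcontent delta (set0 : set 'rV[R]_n) = 0.
Proof.
apply/eqP; rewrite eq_le hcontent_ge0 andbT; apply: ereal_inf_lbound.
by exists set0, (fun=> unit_cube); rewrite esum_set0; split.
Qed.

(** Covers indexed by any countable type are admissible: [pickle] moves the indices into nat, and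
    the default [unit_cube] is never met on the image of [S]. *)
Lemma hcontent_le_esum delta E (I : countType) (S : set I) (Q : I -> cube R n) :
  E `<=` \bigcup_(i in S) cube_set (Q i) ->
  hcontent delta E <= \esum_(i in S) (cost delta (Q i))%:E.
Proof.
move=> EQ; apply: ereal_inf_lbound.
pose Q' k := oapp Q unit_cube (unpickle k).
exists (pickle @` S), Q'; split.
  by move=> x /EQ[i Si Qx]; exists (pickle i); [exists i|rewrite /Q' pickleK].
rewrite esum_image; last first.
  by move=> x y _ _; exact: (pcan_inj pickleK).
by apply: eq_esum => i _; rewrite /Q' pickleK.
Qed.

Lemma hcontent_lt_cover delta E s : hcontent delta E < s ->
  exists (D : set nat) (Q : nat -> cube R n),
    E `<=` \bigcup_(i in D) cube_set (Q i) /\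
    \esum_(i in D) (cost delta (Q i))%:E < s.
Proof.
by move=> /ereal_inf_lt[_ [D [Q [EQ ->]]] ?]; exists D, Q.
Qed.

Lemma hcontent_cube_le delta Q : hcontent delta Q <= (cost delta Q)%:E.
Proof.
rewrite -(@esum_set1 _ unit tt (fun=> (cost delta Q)%:E)) ?cost_ge0//.
by apply: hcontent_le_esum => x Qx; exists tt.
Qed.

Lemma hcontent_bigcup_nat delta (F : nat -> set 'rV[R]_n) :
  hcontent delta (\bigcup_k F k) <= \sum_(k <oo) hcontent delta (F k).
Proof.
(* A near-optimal cover with strict excess e / 2^(k+1) exists only for sets of finite content, so an
   infinite term is treated apart. *)
have [Foo|] := pselect (exists k, hcontent delta (F k) = +oo).
  have [k Fk] := Foo; rewrite nneseries_esumT; last by move=> *; exact: hcontent_ge0.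
  have -> : \esum_(i in [set: nat]) hcontent delta (F i) = +oo.
    apply/eqP; rewrite -leye_eq; apply: esum_ge; exists [set k] => //.
    by rewrite fsbig_set1 Fk.
  exact: leey.
move=> Foo.
have Ffin k : hcontent delta (F k) < +oo.
  by rewrite ltey; apply/eqP => Fk; apply: Foo; exists k.
apply/lee_addgt0Pr => e e0.
apply: le_trans; last first.
  by apply: epsilon_trick; [move=> k; exact: hcontent_ge0|exact: ltW].
have cov k : exists DQ : set nat * (nat -> cube R n),
    F k `<=` \bigcup_(i in DQ.1) cube_set (DQ.2 i) /\
    \esum_(i in DQ.1) (cost delta (DQ.2 i))%:E
      < hcontent delta (F k) + (e / (2 ^ k.+1)%:R)%:E.
  have : hcontent delta (F k) < hcontent delta (F k) + (e / (2 ^ k.+1)%:R)%:E.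
    rewrite lteDl ?fin_numElt ?Ffin ?(lt_le_trans _ (hcontent_ge0 _ _))//.
    by rewrite lte_fin divr_gt0// ltr0n expn_gt0.
  by move=> /hcontent_lt_cover[D [Q ?]]; exists (D, Q).
have [DQ DQP] := choice cov.
rewrite nneseries_esumT; last first.
  move=> k; rewrite adde_ge0 ?hcontent_ge0// lee_fin divr_ge0//; exact: ltW.
apply: (@le_trans _ _ (\esum_(k in [set: nat])
   \esum_(i in (DQ k).1) (cost delta ((DQ k).2 i))%:E)); last first.
  by apply: le_esum => k _; apply: ltW; have [] := DQP k.
rewrite esum_esum; last by move=> *; exact: cost_ge0.
apply: hcontent_le_esum => x [k _ Fx].
by have [/(_ _ Fx)[i Di Qx] _] := DQP k; exists (k, i).
Qed.

(** The sets are spread over nat along [pickle]; an index that is not the code of an element of [S]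
    receives the empty set and adds nothing. *)
Lemma hcontent_bigcup delta E (I : countType) (S : set I)
    (F : I -> set 'rV[R]_n) : E `<=` \bigcup_(i in S) F i ->
  hcontent delta E <= \esum_(i in S) hcontent delta (F i).
Proof.
move=> EF.
pose F' k := [set x | exists2 i, S i /\ pickle i = k & F i x].
apply: (@le_trans _ _ (hcontent delta (\bigcup_k F' k))).
  by apply: le_hcontent => x /EF[i Si Fx]; exists (pickle i) => //; exists i.
apply: le_trans (hcontent_bigcup_nat _ _) _.
rewrite nneseries_esumT; last by move=> *; exact: hcontent_ge0.
rewrite (esumID (pickle @` S)); last by move=> *; exact: hcontent_ge0.
rewrite [X in _ + X]esum1 ?adde0; last first.
  move=> k [_ kS]; rewrite (_ : F' k = set0) ?hcontent0//.
  by rewrite -subset0 => x [i [Si ik] _]; apply: kS; exists i.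
rewrite setTI esum_image; last by move=> x y _ _; exact: (pcan_inj pickleK).
apply: le_esum => i Si; apply: le_hcontent => x [j [Sj /(pcan_inj pickleK)->]] //.
Qed.

Lemma hcontentU delta E F G : E `<=` F `|` G ->
  hcontent delta E <= hcontent delta F + hcontent delta G.
Proof.
move=> EFG.
have -> : hcontent delta F + hcontent delta G =
    \esum_(b in [set: bool]) hcontent delta (if b then F else G).
  rewrite (esumID [set true]); last by move=> *; exact: hcontent_ge0.
  rewrite !setTI (_ : ~` [set true] = [set false]); last first.
    by apply/seteqP; split => -[] //=.
  by rewrite !esum_set1 ?hcontent_ge0.
apply: hcontent_bigcup => x /EFG[Fx|Gx]; [by exists true|by exists false].
Qed.

End HausdorffContent.

(** * The content of a cube *)

Lemma integral_indic_ocitv (R : realType) (c a l : R) : (0 <= c)%R -> (0 <= l)%R ->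
  \int[lebesgue_measure]_y (c * \1_(`]a, (a + l)%R]%classic : set R) y)%:E
    = (c * l)%:E.
Proof.
move=> c0 l0.
under eq_integral do rewrite EFinM.
rewrite ge0_integralZl_EFin//; last first.
  exact/measurable_EFinP/measurable_indic.
rewrite integral_indic// setIT.
have := lebesgue_measure_itv `]a, (a + l)%R].
rewrite /= lte_fin => muE; rewrite [X in _ * X]muE; case: ifPn => [_|].
  by rewrite -EFinB -EFinM addrAC subrr add0r.
rewrite -leNgt => al; have -> : l = 0%R by lra.
by rewrite mule0 mulr0.
Qed.

(* Integrating out one coordinate at a time avoids an n-dimensional measure. *)
Lemma ocbox_volume_le (R : realType) (b : nat -> R) (L : R) (c l : nat -> R)
    (a : nat -> nat -> R) (c0 : R) (k : nat) :
  (0 <= c0)%R -> (0 <= L)%R -> (forall i, 0 <= c i)%R -> (forall i, 0 <= l i)%R ->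
  (forall x : nat -> R,
    (c0 * \prod_(j < k) \1_(`]b j, (b j + L)%R]%classic : set R) (x j))%:E <=
    \sum_(i <oo) (c i * \prod_(j < k)
       \1_(`]a i j, (a i j + l i)%R]%classic : set R) (x j))%:E) ->
  (c0 * L ^+ k)%:E <= \sum_(i <oo) (c i * l i ^+ k)%:E.
Proof.
elim: k c0 c => [|k IH] c0 c c00 L0 cge0 l0 H.
  have := H (fun=> 0%R); under eq_eseriesr do rewrite big_ord0.
  by rewrite big_ord0 expr0; under [in X in _ -> X]eq_eseriesr do rewrite expr0.
rewrite exprS mulrA; under eq_eseriesr do rewrite exprS mulrA.
apply: IH => //; [exact: mulr_ge0|by move=> i; exact: mulr_ge0|].
move=> x.
have prod_ge0 (A : nat -> set R) m (y : nat -> R) :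
    (0 <= \prod_(j < m) \1_(A j) (y j) :> R)%R.
  by apply: prodr_ge0 => j _; rewrite indicE.
(* All coordinates but the last are frozen at [x]; integrating the pointwise hypothesis in [y]
   replaces the last indicators by edge lengths, which join the coefficients. *)
pose xy y j := if j == k then y else x j.
have xyE (A : nat -> set R) y : (\prod_(j < k.+1) \1_(A j) (xy y j) =
    \prod_(j < k) \1_(A j) (x j) * \1_(A k) y :> R)%R.
  rewrite big_ord_recr/= /xy eqxx; congr (_ * _)%R.
  by apply: eq_bigr => j _; rewrite ltn_eqF.
pose P := (\prod_(j < k) \1_(`]b j, (b j + L)%R]%classic : set R) (x j) : R)%R.
pose Pi i := (\prod_(j < k)
  \1_(`]a i j, (a i j + l i)%R]%classic : set R) (x j) : R)%R.
have -> : (c0 * L * P = c0 * P * L)%R by ring.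
have P0 : (0 <= c0 * P)%R.
  by rewrite mulr_ge0//; exact: (prod_ge0 (fun j => `]b j, (b j + L)%R]%classic)).
have Pi0 i : (0 <= c i * Pi i)%R.
  rewrite mulr_ge0//.
  exact: (prod_ge0 (fun j => `]a i j, (a i j + l i)%R]%classic)).
rewrite -(integral_indic_ocitv (b k))//.
rewrite (eq_eseriesr (g := fun i => \int[lebesgue_measure]_y (c i * Pi i *
   \1_(`]a i k, (a i k + l i)%R]%classic : set R) y)%:E)); last first.
  by move=> i _; rewrite integral_indic_ocitv// mulrAC.
have mf (e : R) (A : set R) : measurable A ->
    measurable_fun [set: R] (fun y => (e * \1_A y)%:E).
  move=> mA; have m1 := @measurable_indic _ _ R setT A mA.
  apply/measurable_EFinP; rewrite (_ : (fun y => e * \1_A y)%R = (cst e \* \1_A)%R)//.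
  exact: measurable_funM.
rewrite -integral_nneseries//=.
- apply: ge0_le_integral => //=.
  + by move=> y _; rewrite lee_fin mulr_ge0// indicE.
  + exact: mf.
  + apply: ge0_emeasurable_sum => // [i y _ _|i _].
      by rewrite lee_fin mulr_ge0// indicE.
    exact: mf.
  + move=> y _; have := H (xy y).
    rewrite (xyE (fun j => `]b j, (b j + L)%R]%classic)) mulrA.
    under eq_eseriesr do
      rewrite (xyE (fun j => `]a _ j, (a _ j + l _)%R]%classic)) mulrA.
    by [].
- by move=> i; exact: mf.
- by move=> i y _; rewrite lee_fin mulr_ge0// indicE.
Qed.

(** A covering cube with edge at least that of [Q] suffices alone. Otherwise all ratios e / L are
    below 1, and [delta <= n] gives (e / L)^n <= (e / L)^delta, which reduces the claim to comparing
    volumes. *)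
Lemma hcontent_cube (R : realType) (n : nat) (delta : R) (Q : cube R n) :
  (0 < delta)%R -> (delta <= n%:R)%R -> hcontent delta Q = (cost delta Q)%:E.
Proof.
move=> d0 dn; apply/eqP; rewrite eq_le hcontent_cube_le/=.
apply: le_ereal_inf_tmp => _ [D [P [QP ->]]].
pose e i := (edge (P i))%:num; pose L := (edge Q)%:num.
have L0 : (0 < L)%R by rewrite /L.
have e0 i : (0 < e i)%R by rewrite /e.
have [[i Di Li]|smallP] := pselect (exists2 i, D i & (L <= e i)%R).
  apply: esum_ge; exists [set i]; first by split => // _ ->.
  by rewrite fsbig_set1 lee_fin; apply: ge0_ler_powR => //; rewrite ?nnegrE ltW.
have small j : D j -> (e j < L)%R.
  by move=> Dj; rewrite ltNge; apply/negP => ?; apply: smallP; exists j.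
have vol : (1 * L ^+ n)%:E <= \sum_(i <oo) (\1_D i * e i ^+ n)%:E.
  (* [ocbox_volume_le] works with sequences, so corners are extended by 0; only the first [n]
     entries are ever read. *)
  pose crd (C : cube R n) (j : nat) : R :=
    if insub j is Some i then corner C 0%R i else 0%R.
  apply: (@ocbox_volume_le _ (crd Q) L _ _ (fun i => crd (P i))) => //.
  - exact: ltW.
  - by move=> i; exact: ltW.
  move=> x; pose X : 'rV[R]_n := (\row_(j < n) x j)%R.
  have prodE (C : cube R n) : (\prod_(j < n)
      \1_(`]crd C j, (crd C j + (edge C)%:num)%R]%classic : set R) (x j)
      = \1_(cube_set C) X :> R)%R.
    rewrite [RHS]indicE; have [|] := boolP (X \in _); rewrite ?inE ?notin_setE => CX.
      apply: big1 => j _; rewrite /crd valK indicE mem_set//= in_itv/=.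
      by have := CX j; rewrite mxE.
    have [j Cj] : exists j,
        ~ (corner C 0%R j < X 0%R j <= corner C 0%R j + (edge C)%:num)%R.
      by apply/existsNP => CX'; apply: CX.
    apply/eqP/prodf_eq0; exists j => //; rewrite /crd valK indicE memNset//= in_itv/=.
    by move=> ?; apply: Cj; rewrite mxE.
  rewrite prodE; under eq_eseriesr do rewrite prodE.
  rewrite mul1r indicE; have [|] := boolP (X \in _); last first.
    by move=> _; apply: nneseries_ge0 => i _ _; rewrite lee_fin !indicE mulr_ge0.
  move=> /set_mem/QP[i Di PX]; rewrite nneseries_esumT; last first.
    by move=> j; rewrite lee_fin !indicE mulr_ge0.
  apply: esum_ge; exists [set i] => //.
  by rewrite fsbig_set1 !indicE !mem_set// mul1r.
have key i : D i -> ((L `^ delta * (L ^+ n)^-1) * e i ^+ n <= e i `^ delta)%R.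
  move=> Di; have eL : (0 < e i / L)%R by rewrite divr_gt0.
  have -> : (L `^ delta / L ^+ n * e i ^+ n = (e i / L) ^+ n * L `^ delta)%R.
    by rewrite expr_div_n; ring.
  have -> : (e i `^ delta = (e i / L) `^ delta * L `^ delta)%R.
    by rewrite -powRM ?ltW// divfK// gt_eqF.
  rewrite ler_pM2r ?powR_gt0// -powR_mulrn; last exact: ltW.
  by apply: ger_powR => //; rewrite eL/= ler_pdivrMr// mul1r ltW// small.
have Ln : (0 < L ^+ n)%R by exact: exprn_gt0.
apply: (@le_trans _ _ ((L `^ delta * (L ^+ n)^-1)%:E * (1 * L ^+ n)%:E)).
  by rewrite -EFinM mul1r mulfVK// gt_eqF.
apply: (@le_trans _ _ (\esum_(i in D)
    ((L `^ delta * (L ^+ n)^-1) * e i ^+ n)%:E)); last first.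
  by apply: le_esum => i Di; rewrite lee_fin key.
have -> : \esum_(i in D) ((L `^ delta * (L ^+ n)^-1) * e i ^+ n)%:E =
    (L `^ delta * (L ^+ n)^-1)%:E * \sum_(i <oo) (\1_D i * e i ^+ n)%:E.
  rewrite -nneseriesZl; last first.
    by move=> i _; rewrite lee_fin mulr_ge0 ?indicE ?exprn_ge0 ?(ltW (e0 i)).
  rewrite nneseries_esumT; last first.
    move=> i; rewrite -EFinM lee_fin !mulr_ge0 ?powR_ge0 ?indicE//.
      by rewrite invr_ge0 ltW.
    by rewrite exprn_ge0 ?(ltW (e0 i)).
  rewrite esum_mkcond; apply: eq_esum => i _; rewrite indicE -EFinM.
  by case: ifP => _; rewrite ?mul1r// mul0r mulr0.
by apply: lee_wpmul2l => //; rewrite lee_fin mulr_ge0 ?powR_ge0 ?invr_ge0 ?(ltW Ln).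
Qed.

(** * The Choquet integral and its subadditivity *)

(** Superlevel sets of a nonincreasing function are intervals. Distribution functions are therefore
    measurable even when the integrand is not. *)
Lemma nonincreasing_emeasurable (R : realType) (D : set R) (h : R -> \bar R) :
  (forall s t, (s <= t)%R -> h t <= h s) -> measurable_fun D h.
Proof.
move=> hni mD; apply: (measurability _ (ErealGenOInfty.measurableE R)) => //.
move=> _ [_ [r ->] <-]; apply: measurableI => //.
apply: is_interval_measurable => s t /=; rewrite !in_itv/= !andbT.
by move=> _ ht u /andP[_ ut]; rewrite in_itv/= andbT (lt_le_trans ht)// hni.
Qed.

(** Change of variables, for the homogeneity of the Choquet integral: the pushforward of Lebesgue
    measure under t -> t / c, divided by c, agrees with Lebesgue measure on half-open intervals,
    hence everywhere. *)
Lemma ge0_integral_scale (R : realType) (c : R) (h : R -> \bar R) :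
  (0 < c)%R -> measurable_fun setT h -> (forall t, 0 <= h t) ->
  \int[lebesgue_measure]_(t in `[0%R, +oo[) h (c^-1 * t)%R =
  c%:E * \int[lebesgue_measure]_(t in `[0%R, +oo[) h t.
Proof.
move=> c0 mh h0; have cV0 : (0 < c^-1)%R by rewrite invr_gt0.
pose f : measurableTypeR R -> measurableTypeR R := fun t : R => (c^-1 * t)%R.
have mf : measurable_fun [set: measurableTypeR R] f by exact: measurable_funM.
pose mu : {measure set (measurableTypeR R) -> \bar R} := lebesgue_measure.
pose nu0 := mscale (NngNum (ltW cV0)) (pushforward mu f).
pose nu : {measure set (measurableTypeR R) -> \bar R} := nu0 mf.
have muE (A : set (measurableTypeR R)) : measurable A -> mu A = nu A.
  apply: (@lebesgue_measure_unique R nu) => _ [[a b] /= _ <-].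
  have pre : f @^-1` (`]a, b]%classic : set R) = `](c * a)%R, (c * b)%R]%classic.
    apply/seteqP; split => x; rewrite /= /f !in_itv/=;
      by rewrite ltr_pdivlMl// ler_pdivrMl.
  have -> : nu `]a, b]%classic =
      c^-1%:E * lebesgue_measure (`](c * a)%R, (c * b)%R]%classic : set R).
    by rewrite -pre.
  rewrite (lebesgue_measure_itv `](c * a)%R, (c * b)%R]).
  have := lebesgue_measure_itv `]a, b]; rewrite /= => ->.
  rewrite !lte_fin ltr_pM2l//; case: ifPn => _; last by rewrite mule0.
  by rewrite -!EFinB -EFinM -mulrBr mulKf// gt_eqF.
have mI : measurable (`[0%R, +oo[%classic : set (measurableTypeR R)).
  exact: measurable_itv.
have mhI : measurable_fun (`[0%R, +oo[%classic : set (measurableTypeR R)) h.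
  exact: measurable_funS mh.
have -> : \int[lebesgue_measure]_(t in `[0%R, +oo[) h t =
   \int[nu]_(t in `[0%R, +oo[) h t.
  by apply: eq_measure_integral => A mA _; exact: muE.
rewrite ge0_integral_mscale// muleA -EFinM/= mulfV ?gt_eqF// mul1e.
rewrite [RHS](@ge0_integral_pushforward _ _ (measurableTypeR R)
  (measurableTypeR R) R f mf mu `[0%R, +oo[%classic h mI)//.
congr integral; apply/seteqP; split => t; rewrite /= !in_itv/= !andbT /f.
  by move=> t0; rewrite mulr_ge0// ltW.
by rewrite pmulr_rge0.
Qed.

Section Choquet.
Context {R : realType} {n : nat} (delta : R).
Implicit Types (E : set 'rV[R]_n) (f g : 'rV[R]_n -> \bar R) (s t : R).

Definition dist E f t := hcontent delta [set x | E x /\ t%:E < f x].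

Lemma dist_ge0 E f t : 0 <= dist E f t.
Proof. exact: hcontent_ge0. Qed.

Lemma le_dist E f s t : (s <= t)%R -> dist E f t <= dist E f s.
Proof.
move=> st; apply: le_hcontent => x [Ex tf]; split => //.
by rewrite (le_lt_trans _ tf)// lee_fin.
Qed.

Lemma measurable_dist E f (D : set R) : measurable_fun D (dist E f).
Proof. by apply: nonincreasing_emeasurable => s t; exact: le_dist. Qed.

Lemma choquet_ge0 E f : 0 <= choquet delta E f.
Proof. by apply: integral_ge0 => t _; exact: dist_ge0. Qed.

Lemma le_choquet E f E' g : (forall t, (0 <= t)%R -> dist E f t <= dist E' g t) ->
  choquet delta E f <= choquet delta E' g.
Proof.
move=> h; apply: ge0_le_integral => //.
- by move=> t _; exact: dist_ge0.
- exact: measurable_dist.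
- exact: measurable_dist.
- by move=> t /=; rewrite in_itv/= andbT; exact: h.
Qed.

Lemma choquet_subset E E' f : E `<=` E' -> choquet delta E f <= choquet delta E' f.
Proof.
by move=> EE'; apply: le_choquet => t _; apply: le_hcontent => x [/EE'].
Qed.

Lemma choquet_le_fun E f g : (forall x, E x -> f x <= g x) ->
  choquet delta E f <= choquet delta E g.
Proof.
move=> fg; apply: le_choquet => t _; apply: le_hcontent => x [Ex tf].
by split => //; rewrite (lt_le_trans tf)// fg.
Qed.

(** On [[0, t]] the nonincreasing distribution function is at least its value at [t]. *)
Lemma choquet_chebyshev E f t : (0 <= t)%R ->
  t%:E * dist E f t <= choquet delta E f.
Proof.
move=> t0; apply: (@le_trans _ _ (\int[lebesgue_measure]_(s in `[0%R, t]) dist E f s)).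
  apply: (@le_trans _ _ (\int[lebesgue_measure]_(s in `[0%R, t]) cst (dist E f t) s)).
    rewrite integral_cst//; have := lebesgue_measure_itv `[0%R, t].
    rewrite /= lte_fin => ->; rewrite muleC.
    case: ifPn => [_|]; first by rewrite EFinN sube0.
    by rewrite -leNgt => ?; have -> : t = 0%R by lra.
  apply: ge0_le_integral => //.
  - by move=> *; exact: dist_ge0.
  - exact: measurable_dist.
  - by move=> s /=; rewrite in_itv/= => /andP[_ st]; exact: le_dist.
apply: ge0_subset_integral => //.
- exact: measurable_dist.
- by move=> *; exact: dist_ge0.
- by move=> s /=; rewrite !in_itv/= andbT => /andP[].
Qed.

(** Superlevel sets are covered at each height separately, so subadditivity of the content passes to
    the integral. The integrand may change with the piece, which allows [f] to be replaced by a
    simpler bound on each layer. *)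
Lemma choquet_le_esum E f (D : set nat) (F : nat -> set 'rV[R]_n)
    (g : nat -> 'rV[R]_n -> \bar R) :
  (forall t x, (0 <= t)%R -> E x -> t%:E < f x ->
    exists2 i, D i & F i x /\ t%:E < g i x) ->
  choquet delta E f <= \esum_(i in D) choquet delta (F i) (g i).
Proof.
move=> EF; pose F' i := [set x | D i /\ F i x].
apply: (@le_trans _ _ (\sum_(i <oo) choquet delta (F' i) (g i))).
  rewrite /choquet -integral_nneseries//.
  - apply: ge0_le_integral => //.
    + by move=> *; exact: dist_ge0.
    + exact: measurable_dist.
    + apply: ge0_emeasurable_sum => *; first exact: dist_ge0.
      exact: measurable_dist.
    + move=> t /=; rewrite in_itv/= andbT => t0.
      apply: le_trans (hcontent_bigcup_nat _ _); apply: le_hcontent => x [Ex tf].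
      by have [i Di [Fx tg]] := EF t x t0 Ex tf; exists i.
  - by move=> i; exact: measurable_dist.
  - by move=> *; exact: dist_ge0.
rewrite nneseries_esumT; last by move=> *; exact: choquet_ge0.
rewrite [leRHS]esum_mkcond; apply: le_esum => i _; case: ifPn => [_|].
  by apply: choquet_subset => x [].
rewrite notin_setE => Di; rewrite /choquet integral0_eq// => t _.
rewrite (_ : [set _ | _] = set0) ?hcontent0//.
by rewrite -subset0 => x [[]].
Qed.

Lemma choquet_bigcup E f (D : set nat) (F : nat -> set 'rV[R]_n) :
  E `<=` \bigcup_(i in D) F i ->
  choquet delta E f <= \esum_(i in D) choquet delta (F i) f.
Proof. by move=> EF; apply: choquet_le_esum => t x _ /EF[i Di Fx]; exists i. Qed.

Lemma choquet_scale E f (c : R) : (0 < c)%R ->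
  choquet delta E (fun x => c%:E * f x) = c%:E * choquet delta E f.
Proof.
move=> c0; rewrite /choquet -ge0_integral_scale//; last 2 first.
- exact: measurable_dist.
- by move=> t; exact: dist_ge0.
apply: eq_integral => t _; congr hcontent; apply/seteqP.
by split => x /= [Ex]; rewrite EFinM lte_pdivrMl.
Qed.

Lemma choquet_cst1 E : choquet delta E (cst 1) = hcontent delta E.
Proof.
have -> : choquet delta E (cst 1) =
    \int[lebesgue_measure]_(t in `[0%R, +oo[)
      (hcontent delta E * (\1_(`[0%R, 1%R[%classic : set R) t)%:E).
  apply: eq_integral => t; rewrite inE/= in_itv/= andbT => t0; rewrite indicE.
  have [t1|t1] := ltP t%:E (1 : \bar R).
    rewrite mem_set/= ?in_itv/= ?t0 -?lte_fin// mule1; congr hcontent.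
    by apply/seteqP; split => x /= => [[]|Ex] //.
  rewrite memNset/= ?in_itv/= ?t0/= -?lte_fin ?ltNge ?t1// mule0.
  rewrite (_ : [set _ | _] = set0) ?hcontent0// -subset0.
  by move=> x /= [].
rewrite ge0_integralZl ?hcontent_ge0//; last first.
  exact/measurable_EFinP/measurable_indic.
rewrite integral_indic// setIidl; last first.
  by move=> t /=; rewrite !in_itv/= andbT => /andP[].
have := @lebesgue_measure_itv R `[0%R, 1%R[; rewrite /= lte_fin ltr01 => muE.
by rewrite [X in _ * X]muE oppr0 adde0 mule1.
Qed.

End Choquet.

(** * Sums over index sets *)

(** Since [e] may fail to be injective, one preimage is chosen for each point of the image; [option]
    keeps the choice total off the image. *)
Lemma esum_image_le (R : realType) (T T' : choiceType) (P : set T)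
    (e : T -> T') (a : T' -> \bar R) : (forall i, P i -> 0 <= a (e i)) ->
  \esum_(j in e @` P) a j <= \esum_(i in P) a (e i).
Proof.
move=> a0.
have sec (j : T') : exists i : option T,
    (e @` P) j -> exists2 k, i = Some k & P k /\ e k = j.
  have [[i Pi <-]|] := pselect ((e @` P) j); first by exists (Some i) => _; exists i.
  by move=> nj; exists None => /nj.
have [g gP] := choice sec.
pose b k := if k is Some i then a (e i) else 0.
have -> : \esum_(j in e @` P) a j = \esum_(k in g @` (e @` P)) b k.
  rewrite (esum_image (e @` P)); last first.
    move=> x y; rewrite !inE => /gP[k gx [_ ex]] /gP[k' gy [_ ey]]; rewrite gx gy.
    by move=> [kk']; rewrite -ex -ey kk'.
  by apply: eq_esum => j /gP[k -> [Pk <-]].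
have <- : \esum_(k in Some @` P) b k = \esum_(i in P) a (e i).
  by rewrite esum_image// => x y _ _ [].
rewrite [leLHS]esum_mkcond [leRHS]esum_mkcond; apply: le_esum => k _.
case: ifPn => [|_]; last first.
  by case: ifPn => // /set_mem[i Pi <-] /=; exact: a0.
by move=> /set_mem[j /gP[i -> [Pi _]] <-]; rewrite mem_set//; exists i.
Qed.

Lemma esum_cst_fin (R : realType) (F : finType) (c : R) : (0 <= c)%R ->
  \esum_(e in [set: F]) c%:E = (#|F|%:R * c)%:E.
Proof.
move=> c0; rewrite esum_fset; [|exact: finite_finset|by move=> i _; rewrite lee_fin].
rewrite (_ : [set: F] = [set` enum F]); last first.
  by apply/seteqP; split => i //= _; rewrite mem_enum.
by rewrite -fsbig_seq ?enum_uniq// sumEFin big_enum/= sumr_const mulr_natl.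
Qed.

Lemma esumZl_le (R : realType) (T : choiceType) (D : set T) (c : R) (a : T -> \bar R) :
  (0 <= c)%R -> (forall i, 0 <= a i) ->
  \esum_(i in D) (c%:E * a i) <= c%:E * \esum_(i in D) a i.
Proof.
move=> c0 a0; apply: ge_ereal_sup => _ [X [finX XD] <-].
rewrite -ge0_mule_fsumr//; apply: lee_wpmul2l; first by rewrite lee_fin.
by apply: esum_ge; exists X.
Qed.

(** * The dyadic grid of a cube *)

Section DyadicGrid.
Context {R : realType} {n : nat} (Q0 : cube R n).
Implicit Types (x z : 'rV[R]_n) (k : nat) (i j : nat * {ffun 'I_n -> int}).

Let step_gt0 k : (0 < (edge Q0)%:num / 2 ^+ k)%R.
Proof. by rewrite divr_gt0// exprn_gt0. Qed.

(* Level k has step l(Q0) / 2^k; a cell is indexed by the ceilings of the scaled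
   coordinates of its points. *)
Definition gstep k : R := (edge Q0)%:num / 2 ^+ k.

(** In scaled coordinates the cell of index m is the half-open interval from m - 1 to m, matching
    the ceiling; hence the shift by 1, and the root has constant index 1. *)
Definition gcube i : cube R n :=
  Cube (\row_t (corner Q0 0%R t + gstep i.1 * (i.2 t - 1)%:~R))%R
       (PosNum (step_gt0 i.1)).

Definition gindex k x : {ffun 'I_n -> int} :=
  [ffun t => Num.ceil ((x 0%R t - corner Q0 0%R t) / gstep k)%R].

Lemma gcubeP i x : cube_set (gcube i) x <-> i.2 = gindex i.1 x.
Proof.
have h0 := step_gt0 i.1; rewrite -/(gstep _) in h0.
split => [ix|ix t].
  apply/ffunP => t; rewrite ffunE; apply/esym/ceil_def.
  have := ix t; rewrite /= mxE -/(gstep _) => /andP[lo up].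
  rewrite ltr_pdivlMr// ler_pdivrMr// [X in (X < _)%R]mulrC [X in (_ <= X)%R]mulrC.
  rewrite ltrBrDl lo/= lerBlDl (le_trans up)// -addrA lerD2l.
  by rewrite rmorphB/= mulrBr mulr1 subrK.
rewrite /= mxE ix ffunE -/(gstep _).
set u := ((_ - _) / _)%R; have /andP[lo up] := ceil_itv u.
move: lo up; rewrite /u ltr_pdivlMr// ler_pdivrMr//.
rewrite [X in (X < _)%R -> _]mulrC [X in _ -> (_ <= X)%R -> _]mulrC.
rewrite ltrBrDl lerBlDl => -> up /=; rewrite (le_trans up)// -addrA lerD2l.
by rewrite rmorphB/= mulrBr mulr1 subrK.
Qed.

(** An integer m bounds the ceiling of u exactly when 2^d m bounds that of 2^d u, so the fine index
    determines the coarse one. *)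
Lemma gindex_coarsen k k' x z : (k <= k')%N ->
  gindex k' x = gindex k' z -> gindex k x = gindex k z.
Proof.
move=> kk' xz; have ceil_le2 (u : R) (m : int) d :
    ((Num.ceil u <= m) = (Num.ceil (2 ^+ d * u) <= 2 ^+ d * m))%R.
  by rewrite !ceil_le_int rmorphM rmorphXn/= ler_pM2l.
have E (y : 'rV[R]_n) t : ((y 0%R t - corner Q0 0%R t) / gstep k' =
    2 ^+ (k' - k) * ((y 0%R t - corner Q0 0%R t) / gstep k))%R.
  rewrite /gstep -{1}(subnK kk') exprD !invfM !invrK; ring.
apply/ffunP => t; rewrite !ffunE; apply/eqP; rewrite eq_le.
have := congr1 (fun f : {ffun 'I_n -> int} => f t) xz; rewrite !ffunE !E => e.
apply/andP; split; rewrite (ceil_le2 _ _ (k' - k)%N).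
  by rewrite e -ceil_le2.
by rewrite -e -ceil_le2.
Qed.

Lemma gcube_nested i j x : cube_set (gcube i) x -> cube_set (gcube j) x ->
  (i.1 <= j.1)%N -> cube_set (gcube j) `<=` cube_set (gcube i).
Proof.
move=> /gcubeP ix /gcubeP jx ij z /gcubeP jz; apply/gcubeP.
by rewrite ix; apply: (gindex_coarsen ij); rewrite -jx jz.
Qed.

Lemma gcube_eq i j x : cube_set (gcube i) x -> cube_set (gcube j) x ->
  i.1 = j.1 -> i = j.
Proof.
case: i j => [ki mi] [kj mj] /gcubeP/= -> /gcubeP/= -> ->; by [].
Qed.

Lemma gcube_mem k x : cube_set (gcube (k, gindex k x)) x.
Proof. exact/gcubeP. Qed.

Definition groot : nat * {ffun 'I_n -> int} := (0%N, [ffun=> 1%R]).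

Lemma gcube_root : cube_set (gcube groot) = Q0.
Proof.
apply/seteqP; split => x xQ t; have := xQ t;
  by rewrite /= !mxE ffunE subrr mulr0 addr0 expr0 divr1.
Qed.

Lemma cost_gcube delta i : cost delta (gcube i) = (gstep i.1 `^ delta)%R.
Proof. by []. Qed.

End DyadicGrid.

(** * Covering sets of small content by stopping cubes *)

Section StoppingCover.
Context {R : realType} {n : nat} (delta : R).
Hypothesis delta_gt0 : (0 < delta)%R.
Implicit Types (E : set 'rV[R]_n) (Q : cube R n).

(** Take the first level whose step is below twice the edge of [P]: the preceding step, if any, is
    at least twice that edge, and steps halve. *)
Lemma gstep_le (Q P : cube R n) : ((edge P)%:num <= (edge Q)%:num)%R ->
  exists k, ((edge P)%:num <= gstep Q k)%R /\ (gstep Q k <= 2 * (edge P)%:num)%R.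
Proof.
move=> PQ; set l := (edge Q)%:num; set p := (edge P)%:num.
have p0 : (0 < p)%R by rewrite /p.
have l0 : (0 < l)%R by rewrite /l.
have ex : exists k, (gstep Q k < 2 * p)%R.
  exists (Num.bound (l / p)); rewrite /gstep -/l ltr_pdivrMr ?exprn_gt0//.
  have := @upper_nthrootP R (l / p) _ (leqnn _); set b := Num.bound _.
  rewrite ltr_pdivrMr// => lb.
  have : (0 <= 2 ^+ b * p)%R by rewrite mulr_ge0 ?exprn_ge0 ?ltW.
  by rewrite -mulrA (mulrC p); lra.
exists (ex_minn ex); case: ex_minnP => -[|k] kp kmin; (split; last exact: ltW).
  by rewrite /gstep expr0 divr1; exact: PQ.
have : ~~ (gstep Q k < 2 * p)%R.
  by apply/negP => /kmin; rewrite ltnn.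
by rewrite -leNgt /gstep exprS invfM mulrCA -/l; lra.
Qed.

(* Keeping the first grid level that is coarse enough costs a factor 2 in the
   edge, and a cube then meets at most 2 cells per coordinate. *)
Lemma grid_cover E Q (u : R) : E `<=` Q -> hcontent delta E < u%:E ->
  (u <= cost delta Q)%R ->
  exists T : set (nat * {ffun 'I_n -> int}),
    E `<=` \bigcup_(i in T) cube_set (gcube Q i) /\
    \esum_(i in T) (cost delta (gcube Q i))%:E <=
      (#|{ffun 'I_n -> bool}|%:R * 2 `^ delta * u)%:E.
Proof.
move=> EQ Eu uQ; have [D [P [EP PD]]] := hcontent_lt_cover Eu.
(* A larger cube would alone cost at least as much as [Q], hence at least [u]. *)
have small d : D d -> ((edge (P d))%:num <= (edge Q)%:num)%R.
  move=> Dd; rewrite leNgt; apply/negP => QP.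
  have : (cost delta Q)%:E < (cost delta Q)%:E.
    apply: (@le_lt_trans _ _ (cost delta (P d))%:E).
      by rewrite lee_fin; apply: ge0_ler_powR; rewrite ?nnegrE ltW.
    apply: (@lt_le_trans _ _ u%:E); last by rewrite lee_fin.
    apply: le_lt_trans PD; apply: esum_ge; exists [set d].
      by split => // _ ->.
    by rewrite fsbig_set1.
  by rewrite ltxx.
have lvl d : exists k, D d ->
    ((edge (P d))%:num <= gstep Q k)%R /\ (gstep Q k <= 2 * (edge (P d))%:num)%R.
  have [/small/gstep_le[k ?]|nD] := pselect (D d); first by exists k.
  by exists 0%N => /nD.
have [k kP] := choice lvl.
pose F := {ffun 'I_n -> bool}.
(* The edge of [P d] is at most one step, so the ceiling of a scaled coordinate in [P d] is the
   floor of that of its corner plus 1 or 2; [e] records which. *)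
pose m (d : nat) (e : F) : {ffun 'I_n -> int} := [ffun t =>
  (Num.floor ((corner (P d) 0 t - corner Q 0 t) / gstep Q (k d)) + 1 + (e t : nat)%:Z)%R].
pose g (de : nat * F) := (k de.1, m de.1 de.2).
pose T := g @` (D `*`` (fun=> setT)).
exists T; split.
  move=> x /EP[d Dd Px].
  pose fl t := Num.floor ((corner (P d) 0 t - corner Q 0 t) / gstep Q (k d))%R.
  pose e : F := [ffun t => (fl t + 1 < gindex Q (k d) x t)%R].
  exists (g (d, e)); first by exists (d, e).
  apply/gcubeP; rewrite /g/=; apply/ffunP => t; rewrite !ffunE -/(fl t).
  have h0 : (0 < gstep Q (k d))%R by rewrite divr_gt0// exprn_gt0.
  have /andP[fl1 fl2] := floor_itv ((corner (P d) 0 t - corner Q 0 t) / gstep Q (k d))%R.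
  rewrite -/(fl t) in fl1 fl2.
  have /andP[x1 x2] := Px t; have [pk _] := kP d Dd.
  have lo : (fl t < Num.ceil ((x 0 t - corner Q 0 t) / gstep Q (k d)))%R.
    rewrite ceil_gt_int (le_lt_trans fl1)// ltr_pM2r ?invr_gt0//.
    by rewrite ltrD2r.
  have up : (Num.ceil ((x 0 t - corner Q 0 t) / gstep Q (k d)) <= fl t + 2)%R.
    rewrite ceil_le_int (_ : (fl t + 2)%:~R = (fl t + 1)%:~R + 1 :> R)%R; last first.
      by rewrite !rmorphD/=; ring.
    apply: le_trans (_ : _ <= (corner (P d) 0 t - corner Q 0 t) / gstep Q (k d) + 1)%R _.
      rewrite -[X in (_ <= _ + X)%R](divff (lt0r_neq0 h0)) -mulrDl ler_pM2r ?invr_gt0//.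
      lra.
    by rewrite lerD2r ltW.
  case: ltP => h; last by lia.
  by lia.
apply: (@le_trans _ _ (\esum_(de in D `*`` (fun=> setT))
    (cost delta (gcube Q (g de)))%:E)).
  by apply: esum_image_le => *; exact: cost_ge0.
rewrite -(@esum_esum _ _ _ D (fun=> setT)
  (fun d e => (cost delta (gcube Q (g (d, e))))%:E)); last by move=> *; exact: cost_ge0.
apply: (@le_trans _ _ (\esum_(d in D) (#|F|%:R * (2 `^ delta * cost delta (P d)))%:E)).
  apply: le_esum => d Dd.
  rewrite (eq_esum (b := fun=> (gstep Q (k d) `^ delta)%:E))//.
  rewrite esum_cst_fin ?powR_ge0// lee_fin ler_wpM2l// -powRM//.
  have [h1 h2] := kP d Dd.
  have h0 : (0 < gstep Q (k d))%R by rewrite divr_gt0// exprn_gt0.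
  by apply: ge0_ler_powR => //; [exact: ltW|rewrite nnegrE ltW|rewrite nnegrE mulr_ge0].
under eq_esum do rewrite mulrA EFinM.
apply: le_trans (esumZl_le _ _ _) _; rewrite ?mulr_ge0 ?powR_ge0//.
  by move=> d; exact: cost_ge0.
rewrite [leRHS]EFinM; apply: lee_wpmul2l; last exact: ltW.
by rewrite lee_fin mulr_ge0 ?powR_ge0.
Qed.

End StoppingCover.

Lemma esum_subset (R : realType) (T : choiceType) (A B : set T) (a : T -> \bar R) :
  A `<=` B -> (forall i, 0 <= a i) ->
  \esum_(i in A) a i <= \esum_(i in B) a i.
Proof.
move=> AB a0; rewrite [leLHS]esum_mkcond [leRHS]esum_mkcond.
apply: le_esum => i _; case: ifPn => [/set_mem/AB Bi|_]; first by rewrite mem_set.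
by case: ifP.
Qed.

(* The grid cubes of a cheap cover are merged into the maximal grid cubes that
   either belong to the cover or in which E has large density; a maximal cube
   inherits small density from its parent. *)
Lemma stopping_cover (R : realType) (n : nat) (delta : R) :
  (0 < delta)%R -> (delta <= n%:R)%R ->
  exists2 K : R, (1 <= K)%R &
  forall (Q : cube R n) (E : set 'rV[R]_n) (u : R), E `<=` Q ->
    hcontent delta E < u%:E -> (K * u <= 2^-1 * cost delta Q)%R ->
    exists (D : set nat) (P : nat -> cube R n),
      [/\ E `<=` \bigcup_(i in D) cube_set (P i),
          \esum_(i in D) (cost delta (P i))%:E <= (K * u)%:E,
          forall i, D i -> cube_set (P i) `<=` Q &
          forall i, D i ->
            hcontent delta (E `&` P i) <= (2^-1 * cost delta (P i))%:E].
Proof.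
move=> d0 dn; pose K1 : R := (#|{ffun 'I_n -> bool}|%:R * 2 `^ delta)%R.
(* A parent costs 2^delta times its child, so density at most [tau] in the parent means density at
   most 1/2 in the child. *)
pose tau : R := (2^-1 * (2 `^ delta)^-1)%R.
have two_gt0 : (0 < (2 : R) `^ delta)%R by rewrite powR_gt0.
have tau0 : (0 < tau)%R by rewrite mulr_gt0 ?invr_gt0.
have K11 : (1 <= K1)%R.
  have h1 : (1 <= (2 : R) `^ delta)%R.
    by rewrite -[leLHS](powRr0 2); apply: ler_powR; [rewrite ler1n|exact: ltW].
  have h2 : (1 <= (#|{ffun 'I_n -> bool}|%:R : R))%R.
    by rewrite ler1n card_ffun card_bool expn_gt0.
  by rewrite -[leLHS]mul1r ler_pM.
(* The summand 1 pays for stopping cells taken from the cover, and [tau^-1] for those selected by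
   density alone. *)
pose K := (K1 * (1 + tau^-1))%R.
have tauV : (0 < tau^-1)%R by rewrite invr_gt0.
have K1K : (K1 <= K)%R by rewrite /K ler_peMr ?lerDl ?(le_trans _ K11)// ltW.
have Ktau : (1 <= K * tau)%R.
  rewrite /K -mulrA mulrDl mul1r mulVf ?gt_eqF//.
  by rewrite (le_trans K11)// ler_peMr ?(le_trans _ K11)// lerDr ltW.
exists K; first exact: le_trans K1K.
move=> Q E u EQ Eu Ku; pose G i := gcube Q i.
have cQ0 := cost_gt0 delta Q.
have u0 : (0 < u)%R by rewrite -lte_fin (le_lt_trans (hcontent_ge0 _ _) Eu).
have K1u : (K1 * u <= 2^-1 * cost delta Q)%R.
  by rewrite (le_trans _ Ku)// ler_wpM2r// ltW.
have [|T [ET sumT]] := grid_cover d0 EQ Eu.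
  have : (1 * u <= K1 * u)%R by rewrite ler_wpM2r// ltW.
  by rewrite mul1r; lra.
pose T' i := T i /\ exists x, E x /\ cube_set (G i) x.
pose dense i := (tau * cost delta (G i))%:E < hcontent delta (E `&` G i).
pose Fam i := T' i \/ dense i.
have Fam_nonempty i : Fam i -> exists x, E x /\ cube_set (G i) x.
  case=> [[]//|]; rewrite /dense => di; apply: contrapT => nE.
  suff : E `&` G i = set0.
    move=> EG; move: di; rewrite EG hcontent0 ltNge lee_fin.
    by rewrite mulr_ge0 ?(ltW tau0) ?(ltW (cost_gt0 _ _)).
  by rewrite -subset0 => x [Ex Gx]; apply: nE; exists x.
pose S i := Fam i /\ forall j, Fam j -> (j.1 < i.1)%N ->
  ~ (cube_set (G i) `<=` cube_set (G j)).
have FamS i : Fam i -> exists2 j, S j & cube_set (G i) `<=` cube_set (G j).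
  move=> Fi; pose lev k := `[< exists j, [/\ Fam j, j.1 = k &
    cube_set (G i) `<=` cube_set (G j)] >].
  have ex : exists k, lev k by exists i.1; apply/asboolP; exists i; split.
  case: (ex_minnP ex) => k /asboolP[j [Fj jk ij]] kmin.
  exists j => //; split => // j' Fj' j'j jj'.
  have /kmin : lev j'.1 by apply/asboolP; exists j'; split => //; exact: subset_trans jj'.
  by rewrite -jk leqNgt j'j.
have ES : E `<=` \bigcup_(i in S) cube_set (G i).
  move=> x Ex; have [i Ti Gx] := ET x Ex.
  have [|j Sj ij] := FamS i; first by left; split => //; exists x.
  by exists j => //; exact: ij.
have Sdisj i j x : S i -> S j -> cube_set (G i) x -> cube_set (G j) x -> i = j.
  move=> [Fi Si] [Fj Sj] ix jx; have [ij|ji|] := ltngtP i.1 j.1.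
  - by have := Sj i Fi ij; case; exact: (gcube_nested ix jx (ltnW ij)).
  - by have := Si j Fj ji; case; exact: (gcube_nested jx ix (ltnW ji)).
  - exact: (gcube_eq ix jx).
have Ssmall i : S i -> hcontent delta (E `&` G i) <= (2^-1 * cost delta (G i))%:E.
  move=> [Fi Si]; have [x [Ex Gx]] := Fam_nonempty i Fi.
  (* The root is never selected, by smallness of [u]: as a cover cell it would be too expensive, and
     as a dense cell it would force [u] to be too large. So a stopping cell has a parent, which is
     not in [Fam]. *)
  case: i => -[|k] m in Fi Si Gx *.
    have root : (0%N, m) = groot :> nat * {ffun _ -> int}.
      apply: (@gcube_eq _ _ Q _ _ x) => //.
      by rewrite gcube_root; exact: EQ.
    have GQ : cost delta (G (0%N, m)) = cost delta Q.
      by rewrite /G cost_gcube /gstep expr0 divr1.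
    case: Fi => [[Tm _]|dm].
      have : (cost delta Q)%:E <= (K1 * u)%:E.
        apply: le_trans sumT; apply: esum_ge; exists [set (0%N, m)].
          by split => // _ ->.
        by rewrite fsbig_set1 GQ.
      by rewrite lee_fin => ?; exfalso; lra.
    have : (tau * cost delta Q)%:E < u%:E.
      rewrite -GQ (lt_trans dm)// (le_lt_trans _ Eu)//.
      by apply: le_hcontent => y [].
    rewrite lte_fin => tu; exfalso.
    have : (K * (tau * cost delta Q) <= K * u)%R.
      by apply: ler_wpM2l; [rewrite (le_trans _ K1K)// (le_trans _ K11)|exact: ltW].
    have : (1 * cost delta Q <= K * tau * cost delta Q)%R by rewrite ler_wpM2r// ltW.
    by rewrite mulrA; lra.
  pose p := (k, gindex Q k x).
  have px : cube_set (G p) x by exact: gcube_mem.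
  have pm : cube_set (G (k.+1, m)) `<=` cube_set (G p).
    by apply: (gcube_nested px Gx) => /=.
  have /not_orP[_ /negP] : ~ Fam p by move=> Fp; exact: (Si p Fp (ltnSn k)).
  rewrite -leNgt => small.
  apply: (@le_trans _ _ (hcontent delta (E `&` G p))).
    by apply: le_hcontent => y [Ey /pm].
  apply: (le_trans small); rewrite lee_fin /G !cost_gcube/= /tau.
  have -> : gstep Q k = (2 * gstep Q k.+1)%R.
    by rewrite /gstep exprS invfM; field; rewrite gt_eqF// exprn_gt0.
  rewrite powRM// ?divr_ge0 ?exprn_ge0//.
  by rewrite -mulrA mulKf ?gt_eqF.
have sumS : \esum_(i in S) (cost delta (G i))%:E <= (K * u)%:E.
  rewrite (esumID T'); last by move=> *; exact: cost_ge0.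
  rewrite /K -mulrA mulrDl mulrDr mul1r EFinD; apply: leeD.
    apply: le_trans sumT; apply: esum_subset; last by move=> *; exact: cost_ge0.
    by move=> i [_ []].
  (* A stopping cell outside [T'] is dense, so it costs at most [tau^-1] times the content of [E] in
     it. By maximality the cells of [T'] meeting it lie inside it, and disjointness of the stopping
     cells prevents counting a cell of [T'] twice. *)
  pose J i := [set j | T' j /\ cube_set (G j) `<=` cube_set (G i)].
  apply: (@le_trans _ _ (\esum_(i in S `&` ~` T')
     (tau^-1%:E * \esum_(j in J i) (cost delta (G j))%:E))).
    apply: le_esum => i [[Fi Si] nTi].
    have di : dense i by case: Fi.
    rewrite lee_pdivlMl//; apply/ltW; apply: lt_le_trans di _.
    apply: le_trans (hcontent_le_esum _ _); first exact: lexx.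
    move=> x [Ex Gx]; have [j Tj jx] := ET x Ex.
    have T'j : T' j by split => //; exists x.
    exists j => //; split => //; have [ij|ji] := leqP i.1 j.1.
      exact: (gcube_nested Gx jx ij).
    by have := Si j (or_introl T'j) ji; case; exact: (gcube_nested jx Gx (ltnW ji)).
  apply: le_trans (esumZl_le _ _ _) _; first exact: ltW.
    by move=> i; apply: esum_ge0 => *; exact: cost_ge0.
  rewrite mulrCA EFinM; apply: lee_wpmul2l; first by rewrite lee_fin ltW.
  apply: le_trans sumT; rewrite esum_esum; last by move=> *; exact: cost_ge0.
  rewrite -(esum_image _ snd (fun j => (cost delta (G j))%:E)).
    by apply: esum_subset => [j [[i j'] /= [_ [[Tj _] _]] <-]//|*]; exact: cost_ge0.
  move=> [i j] [i' j']; rewrite !inE /= => -[[Si _] [T'j ji]] [[Si' _] [_ ji']] jj'.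
  rewrite -{}jj' in ji' *; have [x [_ jx]] := T'j.2.
  by congr pair; exact: (Sdisj _ _ x Si Si' (ji x jx) (ji' x jx)).
exists (pickle @` S), (fun k => oapp G (unit_cube) (unpickle k)); split.
- by move=> x /ES[i Si Gx]; exists (pickle i); [exists i|rewrite pickleK].
- rewrite esum_image; last by move=> x y _ _; exact: (pcan_inj pickleK).
  by rewrite (eq_esum (b := fun i => (cost delta (G i))%:E))// => i _; rewrite pickleK.
- move=> _ [i [Fi _] <-]; rewrite pickleK/= -(gcube_root Q).
  have [x [Ex Gx]] := Fam_nonempty i Fi.
  by apply: (@gcube_nested _ _ Q _ _ x) => //; rewrite gcube_root; exact: EQ.
- by move=> _ [i Si <-]; rewrite pickleK/=; exact: Ssmall.
Qed.

(** * Exponential decay of oscillations *)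

(* If the exceptional set {s < |f - c Q|} is covered by the cubes P of
   stopping_cover, both f - c Q and f - c P are at most s somewhere in P, so
   the constants move by at most 2 s from one generation to the next. *)
Lemma john_nirenberg (R : realType) (n : nat) (delta : R) :
  (0 < delta)%R -> (delta <= n%:R)%R ->
  exists2 gamma : R, (0 < gamma)%R &
  forall (f : 'rV[R]_n -> R) (c : cube R n -> R) (s : R), (0 <= s)%R ->
    (forall Q : cube R n, hcontent delta [set x | cube_set Q x /\ (s < `|f x - c Q|)%R]
       <= (gamma * cost delta Q)%:E) ->
    forall k (Q : cube R n),
      hcontent delta [set x | cube_set Q x /\ (2 * k%:R * s < `|f x - c Q|)%R]
        <= (2^-1 ^+ k * cost delta Q)%:E.
Proof.
move=> d0 dn; have [K K1 cover] := stopping_cover d0 dn.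
have K0 : (0 < K)%R by apply: lt_le_trans K1.
exists (4^-1 * K^-1)%R; first by rewrite mulr_gt0 ?invr_gt0.
move=> f c s s0 osc; elim=> [|k IH] Q.
  rewrite expr0 mul1r; apply: le_trans (hcontent_cube_le delta Q).
  by apply: le_hcontent => x [].
have cQ := cost_gt0 delta Q.
(* Twice the bound given by [gamma], hence strictly above the content; the total cost [K * u] is
   half that of [Q], which yields the factor 1/2 per generation. *)
pose u := (2^-1 * K^-1 * cost delta Q)%R.
have Ku : (K * u = 2^-1 * cost delta Q)%R by rewrite /u; field; rewrite gt_eqF.
have [|||D [P [EP sumP PQ small]]] :=
  cover Q [set x | cube_set Q x /\ (s < `|f x - c Q|)%R] u.
- by move=> x [].
- apply: (le_lt_trans (osc Q)); rewrite lte_fin /u ltr_pM2r// ltr_pM2r ?invr_gt0//.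
  by lra.
- by rewrite Ku.
(* If the constants were further apart, two sets of density at most 1/2 and 1/4 would cover [P i],
   whose content is its full cost. *)
have cP i : D i -> (`|c (P i) - c Q| <= 2 * s)%R.
  move=> Di; apply: contrapT => /negP; rewrite -ltNge => far.
  have : (cost delta (P i))%:E <=
      (2^-1 * cost delta (P i))%:E + (4^-1 * K^-1 * cost delta (P i))%:E.
    rewrite -(hcontent_cube (P i) d0 dn).
    apply: le_trans (leeD (small i Di) (osc (P i))); apply: hcontentU => x Px.
    have [fQ|fQ] := ltP s `|f x - c Q|%R.
      by left; split => //; split => //; exact: PQ Px.
    right; split => //; rewrite ltNge; apply/negP => fP.
    move: far; rewrite ltNge => /negP; apply.
    rewrite (_ : _ - _ = (f x - c Q) - (f x - c (P i)))%R; last by ring.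
    by rewrite (le_trans (ler_normB _ _))//; lra.
  rewrite -EFinD lee_fin -mulrDl -[leLHS]mul1r ler_pM2r ?cost_gt0// leNgt => /negP; apply.
  have : (K^-1 <= 1)%R by rewrite invf_le1.
  by lra.
apply: (@le_trans _ _ (\esum_(i in D) hcontent delta
    [set x | cube_set (P i) x /\ (2 * k%:R * s < `|f x - c (P i)|)%R])).
  apply: hcontent_bigcup => x [Qx fx].
  have [|i Di Px] := EP x.
    split => //; apply: le_lt_trans fx; rewrite -{1}[s]mul1r ler_wpM2r//.
    by rewrite -natr1; have := ler0n R k; lra.
  exists i => //; split => //.
  have : (`|f x - c Q| <= `|f x - c (P i)| + `|c (P i) - c Q|)%R.
    by rewrite (le_trans _ (ler_normD _ _))// addrA subrK.
  by move: fx; rewrite -natr1; have := cP i Di; lra.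
apply: (@le_trans _ _ (\esum_(i in D) ((2^-1 ^+ k)%:E * (cost delta (P i))%:E))).
  by apply: le_esum => i _; rewrite -EFinM; exact: IH.
apply: le_trans (esumZl_le _ _ _) _; first by rewrite exprn_ge0.
  by move=> i; exact: cost_ge0.
rewrite exprSr -mulrA EFinM; apply: lee_wpmul2l; first by rewrite lee_fin exprn_ge0.
by rewrite -Ku.
Qed.

(** * Weights on sets of small content *)

(* All that is used of the A_p condition. *)
Definition Ainfty (R : realType) (n : nat) (delta : R) (w : 'rV[R]_n -> \bar R) :=
  (forall Q : cube R n, 0 < choquet delta Q w < +oo) /\
  forall beta : R, (0 < beta)%R -> exists2 alpha : R, (0 < alpha)%R &
    forall Q : cube R n, hcontent delta [set x | cube_set Q x /\
        w x <= (alpha * (fine (choquet delta Q w) / cost delta Q))%:E]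
      <= (beta * cost delta Q)%:E.

Section WeightedDecay.
Context {R : realType} {n : nat} (delta : R).
Hypotheses (delta_gt0 : (0 < delta)%R) (delta_len : (delta <= n%:R)%R).
Variable w : 'rV[R]_n -> \bar R.
Hypothesis wA : Ainfty delta w.
Implicit Types (E : set 'rV[R]_n) (Q : cube R n).

Local Notation wH Q := (choquet delta (cube_set Q) w).

Lemma choquet_cube_EFin Q : wH Q = (fine (wH Q))%:E.
Proof.
have /andP[w0 wy] := wA.1 Q; rewrite fineK// fin_numElt wy andbT.
by rewrite (lt_trans _ w0)// ltNyr.
Qed.

Lemma fine_choquet_cube_gt0 Q : (0 < fine (wH Q))%R.
Proof. by rewrite -lte_fin -choquet_cube_EFin; have /andP[] := wA.1 Q. Qed.

(* Cover {w > s} by cubes P in which it has small density: since w exceeds a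
   fixed fraction of its average on most of P, that average is O(s). *)
Lemma choquet_superlevel_le : exists2 C : R, (1 <= C)%R &
  forall Q (s u : R), (0 <= s)%R -> dist delta Q w s < u%:E ->
    (C * u <= cost delta Q)%R ->
    choquet delta [set x | cube_set Q x /\ s%:E < w x] w <= (C * (s * u))%:E.
Proof.
have [K K1 cover] := stopping_cover delta_gt0 delta_len.
have K0 : (0 < K)%R by apply: lt_le_trans K1.
have [alpha a0 wa] := wA.2 4^-1%R ltac:(by rewrite invr_gt0).
have aV0 : (0 < alpha^-1)%R by rewrite invr_gt0.
(* The part [2 * K] provides the smallness required by the stopping cover; [K / alpha] is the factor
   in the resulting estimate. *)
pose C := (K * (2 + alpha^-1))%R.
have C2 : (2 * K <= C)%R.
  by rewrite /C mulrDr; have := mulr_gt0 K0 aV0; lra.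
exists C; first by lra.
move=> Q s u s0 du Cu; pose G := [set x | cube_set Q x /\ s%:E < w x].
have u0 : (0 < u)%R by rewrite -lte_fin (le_lt_trans (hcontent_ge0 _ _) du).
have [|||D [P [GP sumP PQ small]]] := cover Q G u.
- by move=> x [].
- exact: du.
- have : (2 * K * u <= C * u)%R by rewrite ler_wpM2r// ltW.
  by rewrite -mulrA; lra.
apply: le_trans (choquet_bigcup _ _ GP) _.
have wP i : D i -> choquet delta (P i) w <= ((s / alpha)%:E * (cost delta (P i))%:E).
  move=> Di; have cP := cost_gt0 delta (P i).
  rewrite choquet_cube_EFin -EFinM lee_fin; set W := fine _.
  rewrite -ler_pdivrMr// ler_pdivlMr// mulrC leNgt; apply/negP => sW.
  have : (cost delta (P i))%:E <=
      (2^-1 * cost delta (P i))%:E + (4^-1 * cost delta (P i))%:E.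
    rewrite -(hcontent_cube (P i) delta_gt0 delta_len).
    apply: le_trans (leeD (small i Di) (wa (P i))); apply: hcontentU => x Px.
    have [sw|ws] := ltP s%:E (w x).
      by left; split => //; split => //; exact: PQ Px.
    by right; split => //; rewrite (le_trans ws)// lee_fin ltW.
  by rewrite -EFinD lee_fin; lra.
apply: (@le_trans _ _ (\esum_(i in D) ((s / alpha)%:E * (cost delta (P i))%:E))).
  by apply: le_esum.
apply: le_trans (esumZl_le _ _ _) _; first by rewrite mulr_ge0// ltW.
  by move=> i; exact: cost_ge0.
apply: (@le_trans _ _ ((s / alpha)%:E * (K * u)%:E)).
  by apply: lee_wpmul2l; rewrite // lee_fin mulr_ge0// ltW.
rewrite -EFinM lee_fin /C.
have -> : (K * (2 + alpha^-1) * (s * u) = 2 * (K * (s * u)) + s / alpha * (K * u))%R.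
  by ring.
by rewrite lerDr !mulr_ge0// ltW.
Qed.

Definition wtail Q (s : R) : \bar R :=
  \int[lebesgue_measure]_(t in `[s, +oo[) dist delta Q w t.

Lemma wtail_ge0 Q s : 0 <= wtail Q s.
Proof. by apply: integral_ge0 => t _; exact: dist_ge0. Qed.

Lemma wtail0 Q : wtail Q 0%R = wH Q. Proof. by []. Qed.

Lemma wtail_split Q r s : (0 <= r <= s)%R ->
  wtail Q r = \int[lebesgue_measure]_(t in `[r, s[) dist delta Q w t + wtail Q s.
Proof.
move=> /andP[r0 rs]; rewrite /wtail.
have -> : (`[r, +oo[%classic : set R) = `[r, s[%classic `|` `[s, +oo[%classic.
  rewrite (@itv_bndbnd_setU _ _ (BLeft r) (BLeft s) +oo%O)//.
rewrite ge0_integral_setU//.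
- exact: measurable_dist.
- by move=> *; exact: dist_ge0.
- apply/disj_setPLR => t /=; rewrite !in_itv/= => /andP[_ ts].
  by rewrite andbT; apply/negP; rewrite -ltNge.
Qed.

Lemma wtail_itv_ge Q r s : (0 <= r <= s)%R ->
  (s - r)%:E * dist delta Q w s <= \int[lebesgue_measure]_(t in `[r, s[) dist delta Q w t.
Proof.
move=> /andP[r0 rs].
apply: (@le_trans _ _ (\int[lebesgue_measure]_(t in `[r, s[) cst (dist delta Q w s) t)).
  rewrite integral_cst//; have := @lebesgue_measure_itv R `[r, s[.
  rewrite /= lte_fin => ->; rewrite muleC.
  case: ifPn => [_|]; first by rewrite EFinB.
  by rewrite -leNgt => sr; have -> : (s - r = 0)%R by lra.
apply: ge0_le_integral => //.
- by move=> *; exact: dist_ge0.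
- exact: measurable_dist.
- by move=> t /=; rewrite in_itv/= => /andP[_ /ltW ts]; exact: le_dist.
Qed.

(** The layer-cake integral is cut at height [s]: below it superlevel sets are bounded by [E], above
    it by those in [Q]. *)
Lemma wtail_itv_le E Q s : (0 <= s)%R -> E `<=` Q ->
  choquet delta E w <= s%:E * hcontent delta E + wtail Q s.
Proof.
move=> s0 EQ; apply: (@le_trans _ _ (
   \int[lebesgue_measure]_(t in `[0%R, s[) dist delta E w t +
   \int[lebesgue_measure]_(t in `[s, +oo[) dist delta E w t)).
  rewrite -ge0_integral_setU//.
  - by rewrite -(@itv_bndbnd_setU _ _ (BLeft 0%R) (BLeft s) +oo%O).
  - exact: measurable_dist.
  - by move=> *; exact: dist_ge0.
  - apply/disj_setPLR => t /=; rewrite !in_itv/= => /andP[_ ts].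
    by rewrite andbT; apply/negP; rewrite -ltNge.
apply: leeD.
  apply: (@le_trans _ _ (\int[lebesgue_measure]_(t in `[0%R, s[)
      cst (hcontent delta E) t)).
    apply: ge0_le_integral => //.
    - by move=> *; exact: dist_ge0.
    - exact: measurable_dist.
    - by move=> t _; apply: le_hcontent => x [].
  rewrite integral_cst//; have := @lebesgue_measure_itv R `[0%R, s[.
  rewrite /= lte_fin => ->; rewrite muleC.
  case: ifPn => [_|]; first by rewrite EFinN sube0.
  by rewrite mul0e mule_ge0// ?hcontent_ge0// lee_fin.
apply: ge0_le_integral => //.
- by move=> *; exact: dist_ge0.
- exact: measurable_dist.
- exact: measurable_dist.
- by move=> t _; apply: le_hcontent => x [/EQ].
Qed.

Lemma wtail_le_superlevel Q s : (0 <= s)%R ->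
  wtail Q s <= choquet delta [set x | cube_set Q x /\ s%:E < w x] w.
Proof.
move=> s0; rewrite /wtail -integral_itv_obnd_cbnd; last exact: measurable_dist.
apply: (@le_trans _ _ (\int[lebesgue_measure]_(t in `]s, +oo[)
   dist delta [set x | cube_set Q x /\ s%:E < w x] w t)).
  apply: ge0_le_integral => //.
  - by move=> *; exact: dist_ge0.
  - exact: measurable_dist.
  - exact: measurable_dist.
  - move=> t /=; rewrite in_itv/= andbT => st; apply: le_hcontent => x [Qx tw].
    by split => //; split => //; rewrite (lt_trans _ tw)// lte_fin.
apply: ge0_subset_integral => //.
- exact: measurable_dist.
- by move=> *; exact: dist_ge0.
- by move=> t /=; rewrite !in_itv/= !andbT => /ltW; exact: le_trans.
Qed.

End WeightedDecay.

(** * Geometric decay of the tails of a weight *)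

Section TailDecay.
Context {R : realType} {n : nat} (delta : R).
Hypotheses (delta_gt0 : (0 < delta)%R) (delta_len : (delta <= n%:R)%R).
Variable w : 'rV[R]_n -> \bar R.
Hypothesis wA : Ainfty delta w.
Implicit Types (E : set 'rV[R]_n) (Q : cube R n).
Local Notation wH Q := (choquet delta (cube_set Q) w).

Lemma wtail_EFin Q s : (0 <= s)%R -> wtail delta w Q s = (fine (wtail delta w Q s))%:E.
Proof.
move=> s0; rewrite fineK// fin_numElt.
rewrite (lt_le_trans (ltNyr 0%R) (wtail_ge0 _ _ _ _))/=.
have /andP[_ wy] := wA.1 Q; apply: le_lt_trans wy.
rewrite -wtail0 (@wtail_split _ _ _ _ _ 0%R s) ?lexx// leeDr//.
by apply: integral_ge0 => t _; exact: dist_ge0.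
Qed.

(* The tail T satisfies T s <= 2 C s h s, where h is the distribution
   function, while T (s / 2) >= s / 2 * h s + T s. *)
Lemma wtail_halving : exists C theta : R, [/\ (1 <= C)%R, (0 < theta < 1)%R &
  forall Q s, (4 * C * (fine (wH Q) / cost delta Q) <= s)%R ->
   (fine (wtail delta w Q s) <= theta * fine (wtail delta w Q (s / 2)))%R].
Proof.
have [C C1 Cw] := choquet_superlevel_le delta_gt0 delta_len wA.
have C0 : (0 < C)%R by apply: lt_le_trans C1.
have CV0 : (0 < C^-1)%R by rewrite invr_gt0.
(* From T s <= 2 C s h the term s / 2 * h is at least T s / (4 C), so T (s / 2) >= (1 + 1 / (4 C)) T
   s. *)
exists C, (1 + (4 * C)^-1)^-1%R; split => //.
  by rewrite invr_gt0 invf_lt1 ?ltrDl ?addr_gt0// invr_gt0 mulr_gt0.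
move=> Q s sge; have W0 := fine_choquet_cube_gt0 wA Q.
have cQ := cost_gt0 delta Q.
have s0 : (0 < s)%R by apply: lt_le_trans sge; rewrite !mulr_gt0// invr_gt0.
have s20 : (0 < s / 2)%R by rewrite divr_gt0.
have dfin : dist delta Q w s = (fine (dist delta Q w s))%:E.
  rewrite fineK// fin_numElt (lt_le_trans (ltNyr 0%R) (dist_ge0 _ _ _ _))/=.
  apply: le_lt_trans (ltry (cost delta Q)).
  by apply: le_trans (hcontent_cube_le delta Q); apply: le_hcontent => x [].
set h := fine (dist delta Q w s) in dfin.
have h0 : (0 <= h)%R by rewrite -lee_fin -dfin dist_ge0.
have sh : (s * h <= fine (wH Q))%R.
  rewrite -lee_fin EFinM -dfin -(choquet_cube_EFin wA).
  exact/choquet_chebyshev/ltW.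
have Ch : (4 * C * h <= cost delta Q)%R.
  rewrite -(ler_pM2r (divr_gt0 W0 cQ)) [leRHS]mulrC divfK ?gt_eqF//.
  by rewrite mulrAC (le_trans _ sh)// ler_wpM2r.
(* The strict bound needed by [Cw] is met by u = 2 h when h > 0; for h = 0 the tail vanishes by
   monotonicity. *)
have tail : (fine (wtail delta w Q s) <= 2 * C * s * h)%R.
  move: h0; rewrite le_eqVlt => /predU1P[h0|h0].
    rewrite -h0 mulr0 /wtail integral0_eq// => t /=.
    rewrite in_itv/= andbT => st; apply/eqP; rewrite eq_le dist_ge0 andbT.
    by apply: le_trans (le_dist _ _ _ st) _; rewrite dfin -h0.
  rewrite -lee_fin -wtail_EFin; last exact: ltW.
  apply: le_trans (wtail_le_superlevel _ _ _ (ltW s0)) _.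
  have -> : (2 * C * s * h = C * (s * (2 * h)))%R by ring.
  apply: Cw; first exact: ltW.
    by rewrite dfin lte_fin; lra.
  by have := mulr_gt0 C0 h0; lra.
have : (s / 2 * h + fine (wtail delta w Q s) <= fine (wtail delta w Q (s / 2)))%R.
  rewrite -lee_fin EFinD -!wtail_EFin ?(ltW s0) ?(ltW s20)// EFinM -dfin.
  have ss : (0 <= s / 2 <= s)%R by rewrite ltW//= ler_pdivrMr// ler_peMr ?ltW// ltr1n.
  rewrite (wtail_split _ _ _ ss) leeD2r//.
  have := wtail_itv_ge delta w Q ss.
  by rewrite (_ : s - s / 2 = s / 2)%R//; lra.
move: tail; set T := fine _; set T2 := fine _ => tail split.
rewrite mulrC ler_pdivlMr ?addr_gt0// ?invr_gt0 ?mulr_gt0//.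
rewrite mulrDr mulr1; suff : (T * (4 * C)^-1 <= s / 2 * h)%R by lra.
rewrite ler_pdivrMr ?mulr_gt0//.
by rewrite (_ : s / 2 * h * (4 * C) = 2 * C * s * h)%R//; field.
Qed.

(** Cut at 4 C 2^k times the average of [w]; [k] halvings lead down to 4 C times the average, where
    the tail is at most the whole integral. *)
Lemma choquet_weight_decay : exists A theta : R, [/\ (0 < A)%R, (0 < theta < 1)%R &
  forall Q E k, E `<=` Q -> choquet delta E w <=
    (A * 2 ^+ k * (fine (wH Q) / cost delta Q))%:E * hcontent delta E +
    (theta ^+ k * fine (wH Q))%:E].
Proof.
have [C [theta [C1 /andP[t0 t1] halving]]] := wtail_halving.
have C0 : (0 < C)%R by apply: lt_le_trans C1.
exists (4 * C)%R, theta; rewrite mulr_gt0// t0 t1; split => // Q E k EQ.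
have W0 := fine_choquet_cube_gt0 wA Q; have cQ := cost_gt0 delta Q.
set om := (fine (wH Q) / cost delta Q)%R.
have om0 : (0 < om)%R by rewrite divr_gt0.
have s_ge0 j : (0 <= 4 * C * 2 ^+ j * om)%R.
  apply: mulr_ge0 (ltW om0).
  exact: mulr_ge0 (mulr_ge0 (ler0n _ _) (ltW C0)) (exprn_ge0 _ (ler0n _ _)).
apply: le_trans (wtail_itv_le delta w (s_ge0 k) EQ) _; apply: leeD => //.
rewrite wtail_EFin// lee_fin; elim: k => [|k IH].
  rewrite (expr0 theta) mul1r -lee_fin -wtail_EFin// -(choquet_cube_EFin wA) -wtail0.
  rewrite (@wtail_split _ _ delta w Q 0%R (4 * C * 2 ^+ 0 * om)%R) ?lexx ?s_ge0// leeDr//.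
  by apply: integral_ge0 => t _; exact: dist_ge0.
apply: le_trans (halving _ _ _) _.
  rewrite -/om (mulrAC (4 * C)%R) ler_peMr ?exprn_ege1 ?ler1n//.
  exact: mulr_ge0 (mulr_ge0 (ler0n _ _) (ltW C0)) (ltW om0).
rewrite [X in (_ <= X * _)%R]exprS -[leRHS]mulrA ler_pM2l//; apply: le_trans IH.
by rewrite exprS (_ : 4 * C * (2 * 2 ^+ k) * om / 2 = 4 * C * 2 ^+ k * om)%R//; field.
Qed.

End TailDecay.

(** * Weighted powers of the oscillation *)

(** Slice [E] into layers of height [U]. On layer [k] the power is at most ((k + 1) U)^q <= U^q 2^(q
    k), so the hypothesis on [rho] makes the sum over the layers geometric of ratio 1/2. *)
Lemma choquet_power_le (R : realType) (n : nat) (delta : R) (E : set 'rV[R]_n)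
    (w : 'rV[R]_n -> \bar R) (g : 'rV[R]_n -> R) (U q B rho : R) :
  (0 < U)%R -> (0 < q)%R -> (0 <= B)%R -> (0 <= rho)%R ->
  (2 `^ q * rho <= 2^-1)%R -> (forall x, 0 <= g x)%R ->
  choquet delta E w <= B%:E ->
  (forall k, choquet delta [set x | E x /\ (k%:R * U < g x)%R] w
     <= (B * rho ^+ k)%:E) ->
  choquet delta E (fun x => (g x `^ q)%:E * w x) <= (2 * U `^ q * B)%:E.
Proof.
move=> U0 q0 B0 r0 rq g0 w0 wk.
pose F k := if k is 0%N then E else [set x | E x /\ (k%:R * U < g x)%R].
pose h k := ((k.+1%:R * U) `^ q)%R.
have h0 k : (0 < h k)%R by rewrite powR_gt0// mulr_gt0.
apply: (@le_trans _ _ (\esum_(k in [set: nat])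
    choquet delta (F k) (fun x => (h k)%:E * w x))).
  apply: choquet_le_esum => t x t0 Ex tf.
  have wx0 : 0 <= w x.
    rewrite leNgt; apply/negP => wx; move: tf; rewrite ltNge => /negP; apply.
    apply: (@le_trans _ _ 0); rewrite ?lee_fin//.
    by rewrite mule_ge0_le0 ?lee_fin ?powR_ge0// ltW.
  have ex : exists k, (g x <= k.+1%:R * U)%R.
    exists (Num.bound (g x / U)); rewrite -ler_pdivrMr//.
    have := archi_boundP (divr_ge0 (g0 x) (ltW U0)); rewrite -natr1; lra.
  case: (ex_minnP ex) => k gk kmin.
  exists k => //; split.
    case: k gk kmin => [//|k] gk kmin /=; split => //; rewrite ltNge; apply/negP => /kmin.
    by rewrite ltnn.
  apply: lt_le_trans tf _; apply: lee_wpmul2r => //; rewrite lee_fin /h.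
  apply: ge0_ler_powR => //; first exact: ltW.
    by rewrite nnegrE.
  by rewrite nnegrE mulr_ge0// ltW.
have wF k : choquet delta (F k) w <= (B * rho ^+ k)%:E.
  by case: k => [|k]; [rewrite expr0 mulr1|exact: wk].
rewrite -nneseries_esumT; last by move=> k; exact: choquet_ge0.
(* The geometric series is summed as the terms eps / 2^(k+1) with eps = 2 U^q B. *)
apply: le_trans (epsilon_trick0 xpredT _); last first.
  by rewrite !mulr_ge0// powR_ge0.
apply: lee_nneseries => [k *|k _]; first exact: choquet_ge0.
rewrite choquet_scale//; apply: (@le_trans _ _ ((h k)%:E * (B * rho ^+ k)%:E)).
  by apply: lee_wpmul2l; rewrite // lee_fin ltW.
rewrite -EFinM lee_fin /h powRM ?(ltW U0)//.
have kq : ((k.+1%:R : R) `^ q <= (2 `^ q) ^+ k)%R.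
  rewrite -powR_mulrn ?powR_ge0// powRAC; apply: ge0_ler_powR; first exact: ltW.
  - by rewrite nnegrE.
  - by rewrite nnegrE powR_ge0.
  - by rewrite powR_mulrn// -natrX ler_nat ltn_expl.
apply: (@le_trans _ _ (U `^ q * B * (2 `^ q * rho) ^+ k)%R).
  rewrite exprMn [leRHS](_ : _ = (2 `^ q) ^+ k * U `^ q * (B * rho ^+ k))%R; last by ring.
  by rewrite ler_wpM2r ?mulr_ge0 ?exprn_ge0// ler_wpM2r ?powR_ge0.
apply: (@le_trans _ _ (U `^ q * B * 2^-1 ^+ k)%R).
  rewrite ler_wpM2l ?mulr_ge0 ?powR_ge0//.
  by apply: lerXn2r; rewrite ?nnegrE ?mulr_ge0 ?powR_ge0// invr_ge0.
rewrite natrX exprS exprVn invfM le_eqVlt; apply/orP; left; apply/eqP.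
by field; rewrite expf_neq0.
Qed.

Lemma oscillation_power_le (R : realType) (n : nat) (delta : R) :
  (0 < delta)%R -> (delta <= n%:R)%R ->
  exists2 gamma : R, (0 < gamma)%R &
  forall (w : 'rV[R]_n -> \bar R) (q : R), Ainfty delta w -> (0 < q)%R ->
  exists2 C : R, (0 < C)%R &
  forall (f : 'rV[R]_n -> R) (c : cube R n -> R) (s : R), (0 < s)%R ->
    (forall Q : cube R n, hcontent delta [set x | cube_set Q x /\ (s < `|f x - c Q|)%R]
       <= (gamma * cost delta Q)%:E) ->
    forall Q : cube R n,
      choquet delta Q (fun x => (`|f x - c Q| `^ q)%:E * w x)
        <= ((C * s) `^ q * fine (choquet delta Q w))%:E.
Proof.
move=> d0 dn; have [gamma g0 JN] := john_nirenberg d0 dn; exists gamma => //.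
move=> w q wA q0.
have [A [theta [A0 /andP[t0 t1] decay]]] := choquet_weight_decay d0 dn wA.
pose th := Num.max (2^-1)%R theta.
have th0 : (0 < th)%R by rewrite lt_max t0 orbT.
have th1 : (th < 1)%R by rewrite gt_max t1 invf_lt1// ltr1n.
(* Grouping [M] decay steps into one layer lets the decay outweigh the growth 2^q of the power. *)
have [M M0 Mq] : exists2 M, (0 < M)%N & (2 `^ q * th ^+ M <= 2^-1)%R.
  have := cvg_geometric (2 `^ q)%R (_ : `|th| < 1)%R; rewrite ger0_norm ?ltW// => /(_ th1).
  move=> /cvgrPdist_le /(_ 2^-1%R ltac:(by rewrite invr_gt0)) [N _ NP].
  exists N.+1 => //; have := NP N.+1 (leqnSn N); rewrite /= sub0r normrN ger0_norm//.
  by rewrite mulr_ge0 ?powR_ge0// exprn_ge0// ltW.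
pose C := (4 * M%:R * (2 * (A + 1)) `^ q^-1)%R.
have A1 : (0 < 2 * (A + 1))%R by lra.
exists C; first by rewrite !mulr_gt0 ?ltr0n ?powR_gt0.
move=> f c s s0 osc Q; set W := fine _.
have W0 : (0 < W)%R by exact: fine_choquet_cube_gt0.
pose U := (4 * M%:R * s)%R.
have U0 : (0 < U)%R by rewrite !mulr_gt0 ?ltr0n.
have -> : ((C * s) `^ q * W = 2 * U `^ q * ((A + 1) * W))%R.
  have -> : (C * s = U * (2 * (A + 1)) `^ q^-1)%R by rewrite /C /U; ring.
  rewrite powRM ?(ltW U0) ?powR_ge0// -powRrM mulVf ?gt_eqF// powRr1 ?ltW//.
  by ring.
(* With [2 * j] generations the content decays like 4^-j, which beats the factor 2^j of [decay] and
   leaves 2^-j. *)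
have key j : choquet delta [set x | cube_set Q x /\ (4 * j%:R * s < `|f x - c Q|)%R] w
    <= ((A + 1) * W * th ^+ j)%:E.
  set E := [set x | _]; apply: le_trans (decay Q E j _) _; first by move=> x [].
  have HE : hcontent delta E <= (2^-1 ^+ (2 * j) * cost delta Q)%:E.
    apply: le_trans (JN f c s (ltW s0) osc (2 * j)%N Q); apply: le_hcontent => x [Qx fx].
    by split => //; rewrite natrM mulrA (_ : 2 * 2 = 4 :> R)%R//; lra.
  have cQ := cost_gt0 delta Q.
  apply: (@le_trans _ _ ((A * 2 ^+ j * (W / cost delta Q))%:E *
       (2^-1 ^+ (2 * j) * cost delta Q)%:E + (theta ^+ j * W)%:E)).
    apply: leeD => //; apply: lee_wpmul2l => //.
    by rewrite lee_fin !mulr_ge0 ?exprn_ge0 ?invr_ge0 ?(ltW A0) ?(ltW W0) ?(ltW cQ).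
  rewrite -EFinM -EFinD lee_fin.
  have -> : (A * 2 ^+ j * (W / cost delta Q) * (2^-1 ^+ (2 * j) * cost delta Q)
      = A * W * 2^-1 ^+ j)%R.
    rewrite mul2n -addnn exprD !exprVn.
    by field; rewrite expf_neq0//= gt_eqF.
  have h1 : (2^-1 ^+ j <= th ^+ j)%R.
    by apply: lerXn2r; rewrite ?nnegrE ?(ltW th0)// le_max lexx.
  have h2 : (theta ^+ j <= th ^+ j)%R.
    by apply: lerXn2r; rewrite ?nnegrE ?(ltW th0) ?(ltW t0)// le_max lexx orbT.
  have h3 := ler_wpM2l (ltW (mulr_gt0 A0 W0)) h1.
  have h4 := ler_wpM2l (ltW W0) h2.
  by lra.
apply: (@choquet_power_le _ _ _ _ _ _ _ _ _ (th ^+ M)%R) => //.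
- by rewrite mulr_ge0 ?ltW// addr_gt0.
- by rewrite exprn_ge0 ?ltW.
- rewrite choquet_cube_EFin// lee_fin -/W.
  by rewrite -[leLHS]mul1r ler_pM2r//; lra.
move=> k; rewrite -exprM; apply: le_trans (key (M * k)%N).
apply: choquet_subset => x [Qx fx]; split => //; apply: le_lt_trans fx.
by rewrite /U natrM le_eqVlt; apply/orP; left; apply/eqP; ring.
Qed.

(** * Muckenhoupt weights *)

Lemma hcontent_subset_null (R : realType) (n : nat) (delta : R)
    (E F N : set 'rV[R]_n) : hcontent delta N = 0 -> E `<=` F `|` N ->
  hcontent delta E <= hcontent delta F.
Proof. by move=> N0 /(hcontentU delta); rewrite N0 adde0. Qed.

Section Weights.
Context {R : realType} {n : nat} (delta : R).
Hypotheses (delta_gt0 : (0 < delta)%R) (delta_len : (delta <= n%:R)%R).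
Implicit Types (Q : cube R n) (w : 'rV[R]_n -> \bar R).

Lemma choquet_cube_cst1 Q : choquet delta Q (cst 1) = (cost delta Q)%:E.
Proof. by rewrite choquet_cst1 hcontent_cube. Qed.

Lemma Ainfty_cst1 : Ainfty delta (cst 1 : 'rV[R]_n -> \bar R).
Proof.
split=> [Q|beta beta0].
  by rewrite choquet_cube_cst1 lte_fin cost_gt0 ltry.
exists 2^-1%R => [|Q]; first by rewrite invr_gt0.
rewrite (_ : [set _ | _] = set0).
  by rewrite hcontent0 lee_fin mulr_ge0 ?(ltW beta0) ?(ltW (cost_gt0 _ _)).
rewrite -subset0 => x [_]; rewrite choquet_cube_cst1/= divff ?gt_eqF ?cost_gt0//.
by rewrite mulr1 lee_fin; lra.
Qed.

(** The closed cube is compact, which gives finiteness. If the integral vanished, Chebyshev would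
    make each set where w > 1 / (k + 1) null, and with them all of [Q]. *)
Lemma weight_choquet_cube w Q : weight delta w -> 0 < choquet delta Q w < +oo.
Proof.
move=> [wloc w0]; apply/andP; split; last first.
  pose I i : set R := `[corner Q 0%R i, (corner Q 0%R i + (edge Q)%:num)%R]%classic.
  pose K : set 'rV[R]_n := [set v | forall i, I i (v ord0 i)].
  have cK : compact K.
    by apply: (@rV_compact R n I) => i; exact: segment_compact.
  apply: le_lt_trans (wloc K cK).
  apply: (@le_trans _ _ (choquet delta K w)).
    apply: choquet_subset => x Qx i; rewrite /I/= in_itv/=.
    by have /andP[/ltW -> ->] := Qx i.
  by apply: choquet_le_fun => x _; exact: lee_abs.
rewrite lt_neqAle choquet_ge0 andbT; apply/eqP => W0.
have Hk k : hcontent delta [set x | cube_set Q x /\ (k.+1%:R^-1)%:E < w x] = 0.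
  apply/eqP; rewrite eq_le hcontent_ge0 andbT.
  have := choquet_chebyshev delta Q w (_ : 0 <= k.+1%:R^-1)%R.
  rewrite invr_ge0 ler0n -W0 => /(_ isT).
  by rewrite pmule_rle0// lte_fin invr_gt0.
have : hcontent delta Q <= 0.
  apply: le_trans (hcontent_subset_null (F := \bigcup_k
    [set x | cube_set Q x /\ (k.+1%:R^-1)%:E < w x]) w0 _) _.
    move=> x Qx; have [/andP[wx0 wxy]|] := pselect (0 < w x < +oo); last by right.
    left; case E : (w x) wx0 wxy => [r| |] // r0 _.
    exists (Num.bound r^-1) => //; split => //=.
    rewrite lte_fin in r0; rewrite E lte_fin -[ltRHS]invrK ltf_pV2 ?posrE ?invr_gt0//.
    have rV : (0 <= r^-1)%R by rewrite invr_ge0 ltW.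
    by have := archi_boundP rV; move=> /lt_le_trans; apply; rewrite ler_nat.
  apply: le_trans (hcontent_bigcup_nat _ _) _.
  by rewrite eseries0// => k _ _; exact: Hk.
by rewrite hcontent_cube// lee_fin leNgt cost_gt0.
Qed.

(** On [Q] the maximal function dominates the average, so the A_1 bound fails wherever [w] is at
    most 1 / (2 c) times the average; the 2 makes the failure strict. *)
Lemma A1_lower w : weight delta w -> A1_const delta w < +oo ->
  exists2 c : R, (0 < c)%R & forall Q,
    hcontent delta [set x | cube_set Q x /\
      w x <= (c * (fine (choquet delta Q w) / cost delta Q))%:E] = 0.
Proof.
move=> ww /ereal_inf_lt[_ [c [c0 cae] <-] _].
exists (2 * c)^-1%R => [|Q]; first by rewrite invr_gt0 mulr_gt0.
have /andP[W0 Wy] := weight_choquet_cube Q ww; have cQ := cost_gt0 delta Q.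
have WE : choquet delta Q w = (fine (choquet delta Q w))%:E.
  by rewrite fineK// gt0_fin_numE.
have f0 : (0 < fine (choquet delta Q w))%R by rewrite -lte_fin -WE.
set om := (fine _ / _)%R; have om0 : (0 < om)%R by rewrite divr_gt0.
apply/eqP; rewrite eq_le hcontent_ge0 andbT -(hcontent0 (R := R) (n := n) delta).
apply: (hcontent_subset_null cae) => x [Qx wx]; right => /= mx.
have : om%:E <= c%:E * w x.
  apply: le_trans mx; apply: (@le_trans _ _ (choquet_avg delta Q (fun y => `|w y|))); last first.
    by apply: ereal_sup_ubound; exists Q.
  rewrite /choquet_avg hcontent_cube// inver gt_eqF// /om mulrC EFinM -WE.
  apply: lee_wpmul2l; first by rewrite lee_fin invr_ge0 ltW.
  by apply: choquet_le_fun => y _; exact: lee_abs.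
apply/negP; rewrite -ltNge; apply: (@le_lt_trans _ _ (c%:E * ((2 * c)^-1 * om)%:E)).
  by apply: lee_wpmul2l => //; rewrite lee_fin ltW.
rewrite -EFinM lte_fin (_ : c * ((2 * c)^-1 * om) = om / 2)%R; last first.
  by field; rewrite gt_eqF.
by lra.
Qed.

(* Chebyshev for w^(-1/(p-1)): the second factor of the A_p constant bounds
   the content of the set where w is small relative to its average. *)
Lemma Ap_lower w p beta : weight delta w -> (1 < p)%R -> Ap_const delta p w < +oo ->
  (0 < beta)%R ->
  exists2 c : R, (0 < c)%R & forall Q,
    hcontent delta [set x | cube_set Q x /\
      w x <= (c * (fine (choquet delta Q w) / cost delta Q))%:E]
    <= (beta * cost delta Q)%:E.
Proof.
move=> ww p1 Apy beta0; pose r := ((p - 1)^-1)%R.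
have p10 : (0 < p - 1)%R by rewrite subr_gt0.
have r0 : (0 < r)%R by rewrite invr_gt0.
have [A A0 ApA] : exists2 A : R, (0 < A)%R & Ap_const delta p w <= A%:E.
  case E : (Ap_const delta p w) Apy => [a| |] // _.
    by exists (Num.max a 1)%R; rewrite ?lt_max ?ltr01 ?orbT// lee_fin le_max lexx.
  by exists 1%R => //; rewrite leNye.
(* Chebyshev at the height [t] below gives the density 2 (c A)^r, with r = 1 / (p - 1); this choice
   makes it [beta]. *)
pose c := ((beta / 2) `^ (p - 1) / A)%R.
have b20 : (0 < beta / 2)%R by rewrite divr_gt0.
have c0 : (0 < c)%R by rewrite divr_gt0// powR_gt0.
exists c => // Q.
have /andP[W0 Wy] := weight_choquet_cube Q ww; have cQ := cost_gt0 delta Q.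
have WE : choquet delta Q w = (fine (choquet delta Q w))%:E.
  by rewrite fineK// gt0_fin_numE.
have f0 : (0 < fine (choquet delta Q w))%R by rewrite -lte_fin -WE.
set om := (fine _ / _)%R; have om0 : (0 < om)%R by rewrite divr_gt0.
pose sigma x := (w x)^-1 `^ r.
have avgE g : choquet_avg delta Q g = (cost delta Q)^-1%:E * choquet delta Q g.
  by rewrite /choquet_avg hcontent_cube// inver gt_eqF.
have avgw : choquet_avg delta Q w = om%:E by rewrite avgE {1}WE -EFinM mulrC.
have avgs0 : 0 <= choquet_avg delta Q sigma.
  by rewrite avgE mule_ge0 ?choquet_ge0// lee_fin invr_ge0 ltW.
have avgs : choquet_avg delta Q sigma <= ((A / om) `^ r)%:E.
  have : om%:E * choquet_avg delta Q sigma `^ (p - 1) <= A%:E.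
    by rewrite -avgw; apply: le_trans ApA; apply: ereal_sup_ubound; exists Q.
  rewrite -lee_pdivlMl//; case: (choquet_avg delta Q sigma) avgs0 => [v v0|_|//].
    rewrite poweR_EFin -EFinM !lee_fin mulrC => h.
    rewrite lee_fin in v0.
    rewrite -[v](powRr1 v0) -(mulfV (lt0r_neq0 p10)) powRrM.
    by apply: ge0_ler_powR => //; rewrite ?nnegrE ?powR_ge0 ?divr_ge0 ?ltW.
  by rewrite poweRyr ?gt_eqF.
(* Half the least value of [sigma] where 0 < w <= c om, so that [sigma] exceeds [t] strictly
   there. *)
pose t := (2^-1 * ((c * om)^-1) `^ r)%R.
have com0 : (0 < c * om)%R by rewrite mulr_gt0.
have t0 : (0 < t)%R by rewrite mulr_gt0 ?powR_gt0 ?invr_gt0.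
apply: (@le_trans _ _ (dist delta Q sigma t)).
  apply: (hcontent_subset_null ww.2) => x [Qx wx].
  have [/andP[wx0 wxy]|] := pselect (0 < w x < +oo); last by right.
  left; split => //; move: wx wx0; rewrite /sigma.
  case: (w x) wxy => [a _|//|//]; rewrite lee_fin lte_fin => ac a0.
  rewrite inver gt_eqF// poweR_EFin lte_fin.
  have : ((c * om)^-1 `^ r <= a^-1 `^ r)%R.
    apply: ge0_ler_powR; rewrite ?nnegrE ?invr_ge0 ?(ltW a0) ?(ltW com0) ?(ltW r0) ?(ltW p10)//.
    by rewrite lef_pV2.
  have : (0 < (c * om)^-1 `^ r)%R by rewrite powR_gt0// invr_gt0.
  by rewrite /t; lra.
have := choquet_chebyshev delta Q sigma (ltW t0).
rewrite -lee_pdivlMl// => /le_trans; apply.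
have -> : choquet delta Q sigma = (cost delta Q)%:E * choquet_avg delta Q sigma.
  by rewrite avgE muleA -EFinM divff ?mul1e// gt_eqF.
apply: (@le_trans _ _ (t^-1%:E * ((cost delta Q)%:E * ((A / om) `^ r)%:E))).
  apply: lee_wpmul2l; first by rewrite lee_fin invr_ge0 ltW.
  by apply: lee_wpmul2l; rewrite // lee_fin ltW.
rewrite -!EFinM lee_fin mulrCA mulrC ler_pM2r//.
have -> : (t^-1 = 2 * (c * om) `^ r)%R.
  rewrite /t -(powR_inv1 (ltW com0)) powRAC (powR_inv1 (powR_ge0 _ _)).
  by rewrite invfM !invrK.
rewrite -mulrA -powRM ?(ltW com0) ?(ltW (divr_gt0 A0 om0))//.
have -> : (c * om * (A / om) = (beta / 2) `^ (p - 1))%R.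
  by rewrite /c; field; rewrite !gt_eqF.
rewrite -powRrM mulfV ?gt_eqF// powRr1 ?(ltW b20)//; lra.
Qed.

Lemma A_class_Ainfty p w : (1 <= p)%R -> A_class delta p w -> Ainfty delta w.
Proof.
move=> p1 [ww Aw]; split=> [Q|beta beta0]; first exact: weight_choquet_cube.
move: Aw; rewrite /A_const; case: eqP => [_|/eqP pN1] Aw; last first.
  by apply: (Ap_lower ww) Aw _ => //; rewrite lt_neqAle eq_sym pN1.
have [c c0 cP] := A1_lower ww Aw; exists c => // Q; rewrite cP.
by rewrite lee_fin mulr_ge0 ?(ltW beta0) ?(ltW (cost_gt0 _ _)).
Qed.

End Weights.

(** * Comparison of the two norms *)

(** The infima over constants need not be attained; a bound [B] strictly above the norm supplies an
    actual constant for every cube. *)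
Lemma lee_scale_of_lt (R : realType) (C : R) (x y : \bar R) : (0 < C)%R -> 0 <= x ->
  (forall B : R, (0 < B)%R -> x < B%:E -> y <= (C * B)%:E) -> y <= C%:E * x.
Proof.
move=> C0; case: x => [x| |//] x0 H; last by rewrite gt0_muley ?lte_fin// leey.
rewrite lee_fin in x0; apply/lee_addgt0Pr => e e0.
rewrite -EFinM -EFinD (_ : C * x + e = C * (x + e / C))%R; last first.
  by field; rewrite gt_eqF.
have eC : (0 < e / C)%R by rewrite divr_gt0.
by apply: H; rewrite ?lte_fin; lra.
Qed.

Section NormEquivalence.
Context {R : realType} {n : nat} (delta : R).
Hypotheses (delta_gt0 : (0 < delta)%R) (delta_len : (delta <= n%:R)%R).
Implicit Types (Q : cube R n) (f : 'rV[R]_n -> R).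

Let unit_Q : cube R n := unit_cube.

Lemma BMO_norm_ge0 f : 0 <= BMO_norm delta f.
Proof.
apply: (@le_trans _ _ (ereal_inf (range (fun c : R =>
    choquet_avg delta unit_Q (fun x => `|f x - c|%:E))))); last first.
  by apply: ereal_sup_ubound; exists unit_Q.
apply: le_ereal_inf_tmp => _ [c _ <-].
rewrite /choquet_avg hcontent_cube// inver gt_eqF ?cost_gt0//.
by rewrite mule_ge0 ?choquet_ge0// lee_fin invr_ge0 ltW ?cost_gt0.
Qed.

Lemma wBMO_norm_ge0 q w f : 0 <= wBMO_norm delta q w f.
Proof.
apply: (@le_trans _ _ (ereal_inf (range (fun c : R =>
      ((choquet delta unit_Q w)^-1 *
       choquet delta unit_Q (fun x => (`|f x - c| `^ q)%:E * w x)) `^ q^-1)))); last first.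
  by apply: ereal_sup_ubound; exists unit_Q.
by apply: le_ereal_inf_tmp => _ [c _ <-]; exact: poweR_ge0.
Qed.

Variables (w : 'rV[R]_n -> \bar R) (q : R).
Hypotheses (wA : Ainfty delta w) (q_gt0 : (0 < q)%R).

Lemma wBMO_le_BMO : exists2 C : R, (0 < C)%R &
  forall f, wBMO_norm delta q w f <= C%:E * BMO_norm delta f.
Proof.
have [gamma g0 /(_ w q wA q_gt0)[C C0 main]] :=
  oscillation_power_le delta_gt0 delta_len.
exists (C / gamma)%R; first by rewrite divr_gt0.
move=> f; apply: lee_scale_of_lt; [by rewrite divr_gt0|exact: BMO_norm_ge0|].
move=> B B0 fB.
have cQ Q : exists c : R, choquet_avg delta Q (fun x => `|f x - c|%:E) < B%:E.
  have /ereal_inf_lt[_ [c _ <-] ?] : ereal_inf (range (fun c : R =>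
      choquet_avg delta Q (fun x => `|f x - c|%:E))) < B%:E.
    by apply: le_lt_trans fB; apply: ereal_sup_ubound; exists Q.
  by exists c.
have [c cP] := choice cQ.
(* At height B / gamma, Chebyshev turns an average below [B] into density at most [gamma]. *)
have s0 : (0 < B / gamma)%R by rewrite divr_gt0.
have osc Q : hcontent delta [set x | cube_set Q x /\ (B / gamma < `|f x - c Q|)%R]
    <= (gamma * cost delta Q)%:E.
  have cost0 := cost_gt0 delta Q.
  have := choquet_chebyshev delta Q (fun x => `|f x - c Q|%:E) (ltW s0).
  rewrite -lee_pdivlMl// => /le_trans; apply.
  have cB : choquet delta Q (fun x => `|f x - c Q|%:E) <= (cost delta Q)%:E * B%:E.
    rewrite -lee_pdivrMl//; apply/ltW.
    by have := cP Q; rewrite /choquet_avg hcontent_cube// inver gt_eqF.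
  apply: (@le_trans _ _ ((B / gamma)^-1%:E * ((cost delta Q)%:E * B%:E))).
    by apply: lee_wpmul2l => //; rewrite lee_fin invr_ge0 ltW.
  rewrite -!EFinM lee_fin le_eqVlt; apply/orP; left; apply/eqP.
  by field; rewrite !gt_eqF.
apply: ge_ereal_sup => _ [Q _ <-].
apply: ereal_inf_le; exists (((choquet delta Q w)^-1 *
       choquet delta Q (fun x => (`|f x - c Q| `^ q)%:E * w x)) `^ q^-1); first by exists (c Q).
have W0 := fine_choquet_cube_gt0 wA Q.
have WE := choquet_cube_EFin wA Q.
have CB0 : (0 <= C * (B / gamma))%R by rewrite mulr_ge0 ?(ltW C0) ?(ltW s0).
have -> : (C / gamma * B = ((C * (B / gamma)) `^ q) `^ q^-1)%R.
  by rewrite -powRrM mulfV ?gt_eqF// powRr1//; ring.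
rewrite -poweR_EFin WE inver gt_eqF//.
apply: gt0_ler_poweR; first by rewrite invr_ge0 ltW.
- by rewrite in_itv/= leey andbT mule_ge0 ?choquet_ge0// lee_fin invr_ge0 ltW.
- by rewrite in_itv/= leey andbT lee_fin powR_ge0.
- rewrite lee_pdivrMl//; apply: le_trans (main f c _ s0 osc Q) _.
  by rewrite -EFinM mulrC.
Qed.

(* Where w is comparable to its average on Q, a large value of |f - c| makes
   |f - c|^q w large; hence f oscillates little off a small set, which is
   enough for oscillation_power_le with the weight 1. *)
Lemma BMO_le_wBMO : exists2 C : R, (0 < C)%R &
  forall f, BMO_norm delta f <= C%:E * wBMO_norm delta q w f.
Proof.
have [gamma g0 main1] := oscillation_power_le delta_gt0 delta_len.
have [C C0 main] := main1 (cst 1) 1%R (Ainfty_cst1 delta_gt0 delta_len) ltr01.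
have g20 : (0 < gamma / 2)%R by rewrite divr_gt0.
have [alpha a0 wa] := wA.2 _ g20.
(* Chosen so that 1 / (L^q alpha) = gamma / 2, the density left by Chebyshev where [w] is large; the
   set where [w] is small takes the other half of [gamma]. *)
pose L := ((2 / (alpha * gamma)) `^ q^-1)%R.
have ag0 : (0 < 2 / (alpha * gamma))%R by rewrite divr_gt0// mulr_gt0.
have L0 : (0 < L)%R by rewrite powR_gt0.
exists (C * L)%R; first by rewrite mulr_gt0.
move=> f; apply: lee_scale_of_lt; [by rewrite mulr_gt0|exact: wBMO_norm_ge0|].
move=> B B0 fB.
have cQ Q : exists c : R, choquet delta Q (fun x => (`|f x - c| `^ q)%:E * w x)
    <= (B `^ q * fine (choquet delta Q w))%:E.
  have /ereal_inf_lt[_ [c _ <-] cB] : ereal_inf (range (fun c : R =>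
      ((choquet delta Q w)^-1 *
       choquet delta Q (fun x => (`|f x - c| `^ q)%:E * w x)) `^ q^-1)) < B%:E.
    by apply: le_lt_trans fB; apply: ereal_sup_ubound; exists Q.
  exists c; move: cB; rewrite {1}(choquet_cube_EFin wA).
  have W0 := fine_choquet_cube_gt0 wA Q; rewrite inver gt_eqF//.
  set X := _ * _ => XB.
  have X0 : 0 <= X by rewrite mule_ge0 ?choquet_ge0// lee_fin invr_ge0 ltW.
  rewrite mulrC EFinM -lee_pdivrMl// -/X -[X]poweRe1// -(mulVf (lt0r_neq0 q_gt0)).
  rewrite poweRrM -poweR_EFin; apply: gt0_ler_poweR (ltW XB) => //.
  - exact: ltW.
  - by rewrite in_itv/= leey andbT poweR_ge0.
  - by rewrite in_itv/= leey andbT lee_fin ltW.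
have [c cP] := choice cQ.
have s0 : (0 < L * B)%R by rewrite mulr_gt0.
have osc Q : hcontent delta [set x | cube_set Q x /\ (L * B < `|f x - c Q|)%R]
    <= (gamma * cost delta Q)%:E.
  have cost0 := cost_gt0 delta Q.
  have W0 := fine_choquet_cube_gt0 wA Q.
  set om := (fine (choquet delta Q w) / cost delta Q)%R.
  have om0 : (0 < om)%R by rewrite divr_gt0.
  have aom0 : (0 < alpha * om)%R by rewrite mulr_gt0.
  have sq0 : (0 < (L * B) `^ q)%R by rewrite powR_gt0.
  pose t := ((L * B) `^ q * (alpha * om))%R.
  have t0 : (0 < t)%R by rewrite mulr_gt0.
  have H2 : dist delta Q (fun x => (`|f x - c Q| `^ q)%:E * w x) t
      <= (gamma / 2 * cost delta Q)%:E.
    have := le_trans (choquet_chebyshev delta Q _ (ltW t0)) (cP Q).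
    rewrite -lee_pdivlMl// => /le_trans; apply.
    rewrite -EFinM lee_fin le_eqVlt; apply/orP; left; apply/eqP.
    rewrite /t powRM ?(ltW L0) ?(ltW B0)// /L -powRrM mulVf ?gt_eqF// powRr1 ?(ltW ag0)//.
    rewrite /om; field.
    by rewrite !gt_eqF// powR_gt0.
  rewrite [gamma in leRHS]splitr mulrDl EFinD.
  apply: le_trans (leeD (wa Q) H2); apply: hcontentU => x [Qx fx].
  have [wx|wx] := leP (w x) (alpha * om)%:E; [by left|right; split => //].
  have wx0 : 0 <= w x by rewrite (le_trans _ (ltW wx))// lee_fin ltW.
  rewrite /t EFinM; apply: (@lt_le_trans _ _ (((L * B) `^ q)%:E * w x)).
    by rewrite lte_pmul2l// lte_fin.
  apply: lee_wpmul2r => //; rewrite lee_fin.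
  by apply: ge0_ler_powR; rewrite ?nnegrE ?(ltW q_gt0) ?(ltW s0) ?(ltW fx).
apply: ge_ereal_sup => _ [Q _ <-].
apply: ereal_inf_le; exists (choquet_avg delta Q (fun x => `|f x - c Q|%:E)).
  by exists (c Q).
have cost0 := cost_gt0 delta Q.
rewrite /choquet_avg hcontent_cube// inver gt_eqF// lee_pdivrMl//.
have := main f c _ s0 osc Q.
rewrite choquet_cube_cst1//= powRr1; last by rewrite mulr_ge0 ?(ltW C0) ?(ltW s0).
move=> H; apply: le_trans (_ : _ <= (C * (L * B) * cost delta Q)%:E) _; last first.
  by rewrite -EFinM mulrC mulrA.
apply: le_trans H; apply: choquet_le_fun => x _.
by rewrite powRr1// mule1.
Qed.

End NormEquivalence.

Local Close Scope ereal_scope.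
Unset Implicit Arguments.

Theorem theorem1p12 (R : realType) (n : nat) (delta p q : R)
    (w : 'rV[R]_n -> \bar R)
    (hdelta0 : 0 < delta) (hdeltan : delta <= n%:R)
    (hp : 1 <= p) (hq : 0 < q) (hw : A_class delta p w) :
  exists C : R, 0 < C /\
    forall f : 'rV[R]_n -> R, BMO delta f ->
      ((C^-1)%:E * BMO_norm delta f <= wBMO_norm delta q w f)%E /\
      (wBMO_norm delta q w f <= C%:E * BMO_norm delta f)%E.
Proof.
have wA := A_class_Ainfty hdelta0 hdeltan hp hw.
have [C1 C10 H1] := wBMO_le_BMO hdelta0 hdeltan wA hq.
have [C2 C20 H2] := BMO_le_wBMO hdelta0 hdeltan wA hq.
have C0 : 0 < Num.max C1 C2 by rewrite lt_max C10.
exists (Num.max C1 C2); split => // f _; split.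
  rewrite lee_pdivrMl//; apply: le_trans (H2 f) _.
  apply: lee_wpmul2r; first exact: wBMO_norm_ge0.
  by rewrite lee_fin le_max lexx orbT.
apply: le_trans (H1 f) _; apply: lee_wpmul2r; first exact: BMO_norm_ge0.
by rewrite lee_fin le_max lexx.
Qed.
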